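(* Let $G$ be a connected graph on $n\ge 2$ vertices, with cover time $C$, blanket time $B$, and parameter $M$. Then \[ \tfrac12 M\le C\le B\le 10^5\, M\,(\ln\ln n)^2 . \]
   Context: $G$ is a finite connected undirected graph (loops and multiple edges are allowed) with vertex set $V=V(G)$, $|V|=n$. The walk considered is the usual simple random walk on $G$ (at each step, move along a uniformly chosen edge incident with the current vertex); $\pi$ is its stationary distribution, $\pi_i$ proportional to the degree of $i$. Cover time: for $i\in V$, $C(i)$ is the expected number of steps a random walk starting from $i$ takes until it has visited all vertices of $G$; $C=\max_{i\in V}C(i)$. Hitting and commute times: $H(i,j)$ is the expected number of steps a walk started at $i$ needs to reach $j$, and $\kappa(i,j)=H(i,j)+H(j,i)$. For $S\subseteq V$ with $|S|\ge 2$ let $\kappa_S=\min_{i,j\in S,\,i\ne j}\kappa(i,j)$, and \[ M=\max_{S\subseteq V,\ |S|\ge 2}\kappa_S\ln|S| . \] Blanket time: for a walk started at $v$, let $r_T(x)=r_{T,v}(x)$ be the number of visits to $x$ up to time $T$. Let $\mathbf B$ be the first time $T$ at which the ratio $\dfrac{r_T(i)/\pi_i}{r_T(j)/\pi_j}$ is at most $2$ for any two vertices $i,j$ (in particular all vertices have been visited by this time). $B(v)$ is the expectation of $\mathbf B$ for the walk started at $v$, and $B=\max_{v\in V}B(v)$. *)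

(* Defs.v *)
From HB Require Import structures.
From mathcomp Require Import all_boot all_order all_algebra.
From mathcomp Require Import all_classical all_reals all_analysis.

Set Implicit Arguments.
Unset Strict Implicit.
Unset Printing Implicit Defensive.

Import Order.TTheory GRing.Theory Num.Theory.

Local Open Scope classical_set_scope.
Local Open Scope ring_scope.

(* Finite undirected multigraph: an edge with a single end is a loop. *)
Record multigraph := Multigraph {
  vertex :> finType;
  edge : finType;
  ends : edge -> {set vertex};
  card_ends : forall e, (1 <= #|ends e| <= 2)%N }.

Section Graph.
Variable G : multigraph.
Implicit Types x y : G.

Definition adjacent : rel G :=
  fun x y => [exists e : edge G, ends e == [set x; y]%SET].

Definition connected_graph : Prop := forall x y, connect adjacent x y.

(* Each loop counts once: this is the number of edges incident with x, among
   which the walk at x chooses uniformly.  A loop counted twice in the degree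
   is the same, for the walk and for its stationary distribution, as two
   parallel loops here. *)
Definition degree x : nat := #|[set e : edge G | x \in ends e]%SET|.

Definition edges_between x y : nat :=
  #|[set e : edge G | ends e == [set x; y]]%SET|.

Definition transition (R : realType) x y : R :=
  (edges_between x y)%:R / (degree x)%:R.

Definition stationary (R : realType) x : R :=
  (degree x)%:R / (\sum_(y : G) degree y)%:R.

Lemma card_other_end (e : edge G) y :
  #|[set x | ends e == [set x; y]]%SET| = (y \in ends e).
Proof.
case: (boolP (y \in ends e)) => ye; last first.
  apply/eqP; rewrite cards_eq0; apply/eqP/finset.setP => x; rewrite !inE.
  by apply: contraNF ye => /eqP ->; rewrite !inE eqxx orbT.
apply/eqP/cards1P; have /andP[e1 e2] := card_ends e.
have [/eqP/cards1P[z ze]|c1] := eqVneq #|ends e| 1%N.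
  move: ye; rewrite ze inE => /eqP ->; exists z; apply/finset.setP => x.
  rewrite !inE; apply/eqP/eqP => [/finset.setP/(_ x)|->].
    by rewrite !inE eqxx => /eqP.
  by rewrite finset.setUid.
have e_2 : #|ends e| == 2%N by rewrite eqn_leq e2 ltn_neqAle eq_sym c1 e1.
case/cards2P: e_2 => a [b [ab eab]].
wlog yb : a b ab eab / y = b => [wl|].
  have /set2P[yE|yE] : y \in [set a; b]%SET by rewrite -eab.
    by apply: (wl b a); rewrite // ?eab 1?eq_sym// finset.setUC.
  exact: wl ab eab yE.
exists a; apply/finset.setP => x; rewrite eab yb !inE.
apply/eqP/eqP => [/finset.setP/(_ a)|->//].
by rewrite !inE eqxx (negbTE ab) !orbF => /esym/eqP.
Qed.

Lemma sum_edges_between y : (\sum_(x : G) edges_between x y = degree y)%N.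
Proof.
under eq_bigr do rewrite /edges_between -sum1_card big_mkcond /=.
rewrite exchange_big /degree -sum1_card [RHS]big_mkcond.
apply: eq_bigr => e _; transitivity (nat_of_bool (y \in ends e)).
  rewrite -card_other_end -sum1_card [RHS]big_mkcond.
  by apply: eq_bigr => x _; rewrite !inE.
by rewrite inE; case: (y \in _).
Qed.

Lemma stationary_invariant (R : realType) y : (forall x, 0 < degree x)%N ->
  \sum_(x : G) stationary R x * transition R x y = stationary R y.
Proof.
move=> d_gt0; rewrite /stationary /transition; set D := _%:R^-1.
rewrite -[in RHS]sum_edges_between natr_sum mulr_suml; apply: eq_bigr => x _.
by rewrite mulrACA [D * _]mulrC mulrACA mulfV ?mul1r// pnatr_eq0 -lt0n.
Qed.

End Graph.

Section Walk.
Context d (Omega : measurableType d) (R : realType).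
Variables (G : multigraph) (P : probability Omega R).
Implicit Types (v x : G) (X : nat -> Omega -> G).

Definition follows X (p : nat -> G) (t : nat) : set Omega :=
  [set w | forall s, (s <= t)%N -> X s w = p s].

Record simple_random_walk v X : Prop := SimpleRandomWalk {
  walk_measurable : forall t x, measurable [set w | X t w = x];
  walk_start : P [set w | X 0%N w = v] = 1%E;
  walk_step : forall (p : nat -> G) t,
    P (follows X p t.+1) =
      (P (follows X p t) * (transition R (p t) (p t.+1))%:E)%E }.

(* +oo where A never holds *)
Definition first_time (A : nat -> Omega -> Prop) (w : Omega) : \bar R :=
  ereal_inf [set t%:R%:E | t in [set t : nat | A t w]].

Definition expected_time (A : nat -> Omega -> Prop) : \bar R :=
  (\int[P]_w first_time A w)%E.

Definition visited_all X (t : nat) (w : Omega) : Prop :=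
  forall x, exists2 s, (s <= t)%N & X s w = x.

(* times 0, ..., t, the start included *)
Definition visits X (t : nat) x (w : Omega) : nat :=
  count (fun s => X s w == x) (iota 0 t.+1).

(* The first conjunct is needed because division by 0 is 0. *)
Definition blanketed X (t : nat) (w : Omega) : Prop :=
  (forall x, 0 < visits X t x w)%N /\
  forall x y, ((visits X t x w)%:R / stationary R x)
            / ((visits X t y w)%:R / stationary R y) <= 2 :> R.

(* W v is the walk started at v.  All the quantities below depend only on the
   laws of the walks W v, which simple_random_walk determines; in particular
   the joint law of the different W v is irrelevant. *)
Variable W : G -> nat -> Omega -> G.

Definition hitting_time x y : \bar R :=
  expected_time (fun t w => W x t w = y).

Definition commute_time x y : \bar R :=
  (hitting_time x y + hitting_time y x)%E.

Definition cover_time : \bar R :=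
  \big[maxe/-oo%E]_(v : G) expected_time (visited_all (W v)).

Definition blanket_time : \bar R :=
  \big[maxe/-oo%E]_(v : G) expected_time (blanketed (W v)).

Definition min_commute_time (S : {set G}) : \bar R :=
  \big[mine/+oo%E]_(x in S) \big[mine/+oo%E]_(y in S | x != y)
    commute_time x y.

Definition max_commute_log : \bar R :=
  \big[maxe/-oo%E]_(S : {set G} | (2 <= #|S|)%N)
    (min_commute_time S * (ln #|S|%:R)%:E)%E.

End Walk.

(* Main.v *)
(* Let L_x be the number of visits to x divided by pi_x.  With the dipole
   g(u) = H(u,y) - H(u,x) + H(x,y), which lies in [0, kappa(x,y)] and satisfies
   (I - P) g = 1_x / pi_x - 1_y / pi_y, the function 1 + theta g gives an
   exponential supermartingale, whence L_x <= (1 + eta) (L_y + r) except with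
   probability (1 + eta) exp (- eta r / kappa(x,y)), at every fixed time.
   Chaining this along maximal separated sets at scales M / (2^k ln 2), whose
   cardinality is at most 2^(2^k) by definition of M, needs K = O(ln ln n)
   levels to reach all vertices; with eta and r / T of order 1 / K all the L_x
   are within a factor 2 at time T, up to a probability decaying exponentially
   beyond time O(M K^2).

   For the lower bound, reversibility gives H(x,y) = (kappa(x,y) + q(y) - q(x)) / 2
   with q(x) = sum_u pi_u H(u,x).  Starting from a minimiser of q on S, the
   potential [matthews_pot] is a subsolution of the equation satisfied by the
   expected remaining cover time, which is Matthews' random ordering argument
   without the random ordering. *)
Require Import Defs.
From HB Require Import structures.
From mathcomp Require Import all_boot all_order all_algebra.
From mathcomp Require Import all_classical all_reals all_analysis.
From mathcomp Require Import ring lra.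

Set Implicit Arguments.
Unset Strict Implicit.
Unset Printing Implicit Defensive.

Import Order.TTheory GRing.Theory Num.Theory.
Import numFieldNormedType.Exports.

Local Open Scope classical_set_scope.
Local Open Scope ring_scope.

Lemma cvg_bigsum (R : realType) (I : finType) (f : I -> nat -> R) (l : I -> R) :
  (forall i, f i t @[t --> \oo] --> l i) ->
  (\sum_i f i t) @[t --> \oo] --> \sum_i l i.
Proof.
move=> fl; elim: (index_enum I) => [|i s ih].
  by under eq_fun do rewrite big_nil; rewrite big_nil; apply: cvg_cst.
by under eq_fun do rewrite big_cons; rewrite big_cons; apply: cvgD.
Qed.

(** * Reversible chains: hitting and commute times *)

Section Chain.
Variables (R : realType) (V : finType) (p : V -> V -> R) (pi : V -> R).
Implicit Types (t : nat) (x y u v : V) (A S : {set V}) (f : V -> R).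

(** Expectation of [F] over the list of the [t.+1] states at times 0 to t of the chain started at
    [x]. The recursion conditions on the first step, so the Markov property is built in and no
    probability space is needed. *)
Fixpoint walk_exp t x (F : seq V -> R) : R :=
  if t is t'.+1 then \sum_u p x u * walk_exp t' u (fun s => F (x :: s))
  else F [:: x].

Definition step f x : R := \sum_u p x u * f u.

Definition uncovered t A x : R :=
  walk_exp t x (fun s => (~~ (A \subset s))%:R).

(** By the tail-sum formula, the expectation of the minimum of t and the time to cover [A] from [x];
    finite even before any limit is known to exist. *)
Definition cover_sum t A x : R := \sum_(s < t) uncovered s A x.

(* The target comes first: [hit y x] is H(x,y). *)
Definition hit y x : R := limn (fun t => cover_sum t [set y]%SET x).

Definition commute x y : R := hit y x + hit x y.

Hypothesis p_ge0 : forall x y, 0 <= p x y.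
Hypothesis p_sum1 : forall x, \sum_y p x y = 1.
Hypothesis pi_gt0 : forall x, 0 < pi x.
Hypothesis pi_sum1 : \sum_x pi x = 1.
Hypothesis p_reversible : forall x y, pi x * p x y = pi y * p y x.
Hypothesis p_irreducible : forall x y, connect (fun u v => 0 < p u v) x y.

Lemma eq_walk_exp t x F1 F2 : F1 =1 F2 -> walk_exp t x F1 = walk_exp t x F2.
Proof.
by elim: t x F1 F2 => [|t ih] x F1 F2 eqF //=;
  apply: eq_bigr => u _; congr (_ * _); apply: ih => s; rewrite eqF.
Qed.

Lemma le_walk_exp t x F1 F2 :
  (forall s, size s = t.+1 -> F1 s <= F2 s) -> walk_exp t x F1 <= walk_exp t x F2.
Proof.
elim: t x F1 F2 => [|t ih] x F1 F2 leF /=; first exact: leF.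
apply: ler_sum => u _; apply: ler_wpM2l; first exact: p_ge0.
by apply: ih => s ss; apply: leF; rewrite /= ss.
Qed.

Lemma walk_exp_cst t x c : walk_exp t x (fun=> c) = c.
Proof.
elim: t x => [|t ih] x //=; under eq_bigr do rewrite ih.
by rewrite -mulr_suml p_sum1 mul1r.
Qed.

Lemma walk_expZ t x c F : walk_exp t x (fun s => c * F s) = c * walk_exp t x F.
Proof.
elim: t x F => [|t ih] x F //=; rewrite mulr_sumr.
by apply: eq_bigr => u _; rewrite ih mulrCA.
Qed.

Lemma walk_exp_sum t x (I : Type) (r : seq I) (P : pred I) (F : I -> seq V -> R) :
  walk_exp t x (fun s => \sum_(i <- r | P i) F i s)
  = \sum_(i <- r | P i) walk_exp t x (F i).
Proof.
elim: t x F => [|t ih] x F //=; rewrite exchange_big /=.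
by apply: eq_bigr => u _; rewrite ih mulr_sumr.
Qed.

Lemma step_monotone f g x : (forall u, f u <= g u) -> step f x <= step g x.
Proof. by move=> fg; apply: ler_sum => u _; rewrite ler_wpM2l. Qed.

Lemma step_cst c x : step (fun=> c) x = c.
Proof. by rewrite /step -mulr_suml p_sum1 mul1r. Qed.

Lemma stepD f g x : step (fun u => f u + g u) x = step f x + step g x.
Proof. by rewrite -big_split; apply: eq_bigr => u _; rewrite mulrDr. Qed.

Lemma stepZ c f x : step (fun u => c * f u) x = c * step f x.
Proof. by rewrite mulr_sumr; apply: eq_bigr => u _; rewrite mulrCA. Qed.

Lemma uncovered_ge0 t A x : 0 <= uncovered t A x.
Proof.
by rewrite -(walk_exp_cst t x 0); apply: le_walk_exp => s _; rewrite ler0n.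
Qed.

Lemma subset_cons A x (s : seq V) :
  (A \subset x :: s) = (A :\ x \subset s).
Proof.
apply/fintype.subsetP/fintype.subsetP => As u.
  by rewrite !inE => /andP[ux /As]; rewrite inE (negbTE ux).
by move=> uA; rewrite inE; have [//|ux] := eqVneq u x; apply: As; rewrite !inE ux.
Qed.

Lemma uncovered0 A x : uncovered 0 A x = (A :\ x != finset.set0)%:R.
Proof.
rewrite /uncovered /= subset_cons.
suff -> : (A :\ x \subset [::]) = (A :\ x == finset.set0) by [].
by rewrite -finset.subset0; apply/fintype.subsetP/fintype.subsetP => h u /h; rewrite inE.
Qed.

(** The vertices still to be visited and the current position form a Markov chain; this is its
    first-step equation. *)
Lemma uncoveredS t A x : uncovered t.+1 A x = step (uncovered t (A :\ x)) x.
Proof.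
rewrite /uncovered /=; apply: eq_bigr => u _; congr (_ * _).
by apply: eq_walk_exp => s; rewrite subset_cons.
Qed.

Lemma uncoveredD1 t A x : uncovered t (A :\ x) x = uncovered t A x.
Proof.
by case: t => [|t]; rewrite ?uncovered0 ?uncoveredS finset.setDDl finset.setUid.
Qed.

Lemma cover_sum0 A x : cover_sum 0 A x = 0.
Proof. by rewrite /cover_sum big_ord0. Qed.

Lemma cover_sum_ge0 t A x : 0 <= cover_sum t A x.
Proof. by apply: sumr_ge0 => s _; exact: uncovered_ge0. Qed.

Lemma cover_sum_homo A x :
  {homo (fun t => cover_sum t A x) : s t / (s <= t)%N >-> s <= t}.
Proof.
apply: homo_leq => [//|y u v uy|t]; first exact: le_trans.
by rewrite /cover_sum big_ord_recr /= lerDl uncovered_ge0.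
Qed.

Lemma cover_sumD1 t A x : cover_sum t (A :\ x) x = cover_sum t A x.
Proof. by apply: eq_bigr => s _; rewrite uncoveredD1. Qed.

Lemma cover_sumS t A x :
  cover_sum t.+1 A x = (A :\ x != finset.set0)%:R + step (cover_sum t (A :\ x)) x.
Proof.
rewrite /cover_sum big_ord_recl uncovered0; congr (_ + _).
rewrite /step; under [RHS]eq_bigr do rewrite mulr_sumr.
by rewrite [RHS]exchange_big; apply: eq_bigr => s _; rewrite lift0 uncoveredS.
Qed.

Lemma cover_sum_set0 t x : cover_sum t finset.set0 x = 0.
Proof.
by elim: t x => [|t ih] x; rewrite ?cover_sum0// cover_sumS finset.set0D eqxx add0r
  -[RHS](step_cst 0 x); apply: eq_bigr => u _; rewrite ih.
Qed.

Lemma cover_sum_self t x : cover_sum t [set x]%SET x = 0.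
Proof. by rewrite -cover_sumD1 finset.setDv cover_sum_set0. Qed.

Lemma set1D1 x y : x != y -> [set y]%SET :\ x = [set y]%SET.
Proof.
by move=> xy; apply/finset.setP => u; rewrite !inE; case: eqVneq => // ->;
  rewrite (negbTE xy).
Qed.

Lemma cover_sumS_hit t x y : x != y ->
  cover_sum t.+1 [set y]%SET x = 1 + step (cover_sum t [set y]%SET) x.
Proof.
move=> xy; rewrite cover_sumS set1D1//.
suff -> : [set y]%SET != finset.set0 by [].
by apply/finset.set0Pn; exists y; rewrite inE.
Qed.

Lemma stationary_step f : \sum_x pi x * step f x = \sum_x pi x * f x.
Proof.
rewrite /step; under eq_bigr do rewrite mulr_sumr.
rewrite exchange_big /=; apply: eq_bigr => y _.
under eq_bigr do rewrite mulrA p_reversible -mulrA mulrCA.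
by rewrite -mulr_suml p_sum1 mul1r.
Qed.

(* Kac's bound on the return time, from stationarity. *)
Lemma return_sum_bound t y : pi y * step (cover_sum t [set y]%SET) y <= 1.
Proof.
have := stationary_step (cover_sum t [set y]%SET).
rewrite (bigD1 y) //= [RHS](bigD1 y) //= cover_sum_self mulr0 add0r => e.
rewrite -(lerD2r (\sum_(i | i != y) pi i * step (cover_sum t [set y]%SET) i)) e.
have -> : 1 = pi y + \sum_(i | i != y) pi i by rewrite -pi_sum1 (bigD1 y).
rewrite -addrA -big_split /=; apply: ler_wpDl; first exact: ltW.
apply: ler_sum => x xy; rewrite -[X in X + _]mulr1 -mulrDr.
apply: ler_wpM2l; first exact: ltW.
by rewrite -cover_sumS_hit//; apply: cover_sum_homo.
Qed.

(** Kac's bound controls the mean over the successors of [y], hence each successor of [y]. The bound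
    then spreads along a path of positive probability from [y] to [x], restarting from Kac's bound
    whenever the path returns to [y]. *)
Lemma cover_sum_hit_bounded y x : exists B, forall t, cover_sum t [set y]%SET x <= B.
Proof.
have /connectP[s] := p_irreducible y x.
suff main : forall z, path (fun u v => 0 < p u v) z s -> (exists B, forall t,
    step (cover_sum t [set y]%SET) z <= B) -> last z s = x -> x != y ->
    exists B, forall t, cover_sum t [set y]%SET x <= B.
  move=> ps xE; have [->|xy] := eqVneq x y.
    by exists 0 => t; rewrite cover_sum_self.
  apply: (main y) => //; exists (pi y)^-1 => t.
  by rewrite -[leRHS]mul1r ler_pdivlMr// mulrC return_sum_bound.
have nbr z u B : 0 < p z u -> (forall t, step (cover_sum t [set y]%SET) z <= B) ->
    exists B', forall t, cover_sum t [set y]%SET u <= B'.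
  move=> zu zB; exists (B / p z u) => t; rewrite ler_pdivlMr// mulrC.
  apply: le_trans (zB t); rewrite /step (bigD1 u)//= lerDl.
  by apply: sumr_ge0 => v _; rewrite mulr_ge0 ?cover_sum_ge0.
elim: s => [|u s ih] z /=; first by move=> _ [B zB] <- xy; exists (1 + B) => t;
  apply: le_trans (cover_sum_homo _ _ (leqnSn t)) _; rewrite cover_sumS_hit// lerD2l.
move=> /andP[zu us] [B /(nbr _ _ _ zu)[B' uB]] sx xy.
apply: ih us _ sx xy; have [->|uy] := eqVneq u y.
  exists (pi y)^-1 => t.
  by rewrite -[leRHS]mul1r ler_pdivlMr// mulrC return_sum_bound.
exists B' => t; apply: le_trans (uB t.+1).
by rewrite cover_sumS_hit// lerDr.
Qed.

Lemma hit_cvg y x : cover_sum t [set y]%SET x @[t --> \oo] --> hit y x.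
Proof.
have [B yB] := cover_sum_hit_bounded y x.
apply: nondecreasing_is_cvgn; first exact: cover_sum_homo.
by exists B => _ [t _ <-]; exact: yB.
Qed.

Lemma cover_sum_le_hit t y x : cover_sum t [set y]%SET x <= hit y x.
Proof.
apply: nondecreasing_cvgn_le; first exact: cover_sum_homo.
by apply/cvg_ex; eexists; exact: hit_cvg.
Qed.

Lemma hit_ge0 y x : 0 <= hit y x.
Proof. exact: le_trans (cover_sum_ge0 0 _ _) (cover_sum_le_hit _ _ _). Qed.

Lemma hit_self x : hit x x = 0.
Proof.
rewrite /hit; under eq_fun do rewrite cover_sum_self.
exact: lim_cst.
Qed.

Lemma hit_step y x : x != y -> hit y x = 1 + step (hit y) x.
Proof.
move=> xy; have h1 := @hit_cvg y x.
have h2 : (1 + step (cover_sum t [set y]%SET) x) @[t --> \oo] --> 1 + step (hit y) x.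
  apply: cvgD; first exact: cvg_cst.
  by apply: cvg_bigsum => u; apply: cvgM; [exact: cvg_cst | exact: hit_cvg].
move: h1; rewrite -cvg_shiftS => h1.
rewrite -(cvg_lim (@Rhausdorff R) h1) -(cvg_lim (@Rhausdorff R) h2).
by under eq_fun do rewrite (cover_sumS_hit _ xy).
Qed.

(** Kac's formula: the mean return time to [y] is [1 / pi y]. Integrating [hit_step] against [pi],
    invariance cancels everything but the term at [y]. *)
Lemma hit_step_self y : step (hit y) y = (pi y)^-1 - 1.
Proof.
have := stationary_step (hit y).
rewrite (bigD1 y) //= [RHS](bigD1 y) //= hit_self mulr0 add0r.
under [RHS]eq_bigr => i iy do rewrite hit_step// mulrDr mulr1.
rewrite big_split /= => /addIr e.
apply: (mulfI (lt0r_neq0 (pi_gt0 y))); rewrite e mulrBr mulfV ?gt_eqF// mulr1.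
by rewrite -pi_sum1 [in RHS](bigD1 y)//= [RHS]addrC addKr.
Qed.

Lemma hit_ge1 x y : x != y -> 1 <= hit y x.
Proof.
move=> xy; rewrite hit_step// lerDl -(step_cst 0 x).
by apply: step_monotone => u; exact: hit_ge0.
Qed.

(** Minimality of the hitting time among nonnegative supersolutions: induction on t bounds the
    truncated times, then t tends to infinity. *)
Lemma hit_le_supersolution y f : (forall x, 0 <= f x) ->
  (forall x, x != y -> 1 + step f x <= f x) -> forall x, hit y x <= f x.
Proof.
move=> f0 fS x; suff main t : forall x, cover_sum t [set y]%SET x <= f x.
  by apply: (@limr_le _ _ _ _) => //=; [apply/cvg_ex; eexists; exact: hit_cvg
    | exact: nearW].
elim: t => {x} [|t ih] x; first by rewrite cover_sum0.
have [->|xy] := eqVneq x y; first by rewrite cover_sum_self.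
by rewrite cover_sumS_hit//; apply: le_trans (fS _ xy); rewrite lerD2l step_monotone.
Qed.

(* The minimum of [hit y] and [hit x + hit y x] is again a supersolution. *)
Lemma hit_triangle x y u : hit y u <= hit x u + hit y x.
Proof.
pose f v := Order.min (hit y v) (hit x v + hit y x).
suff : hit y u <= f u by rewrite le_min => /andP[].
apply: hit_le_supersolution u => [u|u uy].
  by rewrite le_min hit_ge0 addr_ge0 ?hit_ge0.
have fy : 1 + step f u <= hit y u.
  by rewrite (hit_step uy) lerD2l; apply: step_monotone => v; rewrite ge_min lexx.
rewrite {2}/f le_min fy /=; have [ux|ux] := eqVneq u x.
  by rewrite ux hit_self add0r -ux.
rewrite (hit_step ux) -addrA lerD2l -[X in _ + X](step_cst _ u) -stepD.
by apply: step_monotone => v; rewrite ge_min lexx orbT.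
Qed.

Definition hit_mean x : R := \sum_u pi u * hit x u.

(** The function [step (hit y)] is [hit y - 1], corrected at [y] by [1 / pi y]; integrate this
    against [hit x]. *)
Lemma sum_pi_hit_step x y :
  \sum_u pi u * (hit x u * step (hit y) u) =
  \sum_u pi u * (hit x u * hit y u) - hit_mean x + hit x y.
Proof.
rewrite (bigD1 y) //= [in RHS](bigD1 y) //= /hit_mean [X in _ - X](bigD1 y) //=.
rewrite hit_self hit_step_self.
have -> : \sum_(i | i != y) pi i * (hit x i * step (hit y) i) =
   \sum_(i | i != y) pi i * (hit x i * hit y i) - \sum_(i | i != y) pi i * hit x i.
  by rewrite -sumrB; apply: eq_bigr => i iy; rewrite (hit_step iy); ring.
by have := lt0r_neq0 (pi_gt0 y); move=> ?; field.
Qed.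

Lemma step_selfadjoint f g :
  \sum_u pi u * (f u * step g u) = \sum_u pi u * (g u * step f u).
Proof.
rewrite /step; under eq_bigr do rewrite !mulr_sumr.
under [RHS]eq_bigr do rewrite !mulr_sumr.
rewrite exchange_big; apply: eq_bigr => u _; apply: eq_bigr => v _.
have e := p_reversible u v.
transitivity (pi v * p v u * (f v * g u)); first by ring.
by rewrite -e; ring.
Qed.

(** Reversibility makes [step] self-adjoint for the weights [pi]. Applied to [hit x] and [hit y],
    the products cancel and only the means and the two hitting times remain. *)
Lemma hit_asymmetry x y : hit y x - hit x y = hit_mean y - hit_mean x.
Proof.
have := step_selfadjoint (hit x) (hit y); rewrite !sum_pi_hit_step.
under [X in _ = X - _ + _]eq_bigr do rewrite [_ y _ * _]mulrC.
by move=> e; lra.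
Qed.

Lemma hit_commute x y : hit y x = (commute x y + hit_mean y - hit_mean x) / 2.
Proof. by have := hit_asymmetry x y; rewrite /commute; lra. Qed.

Lemma commuteC x y : commute x y = commute y x.
Proof. by rewrite /commute addrC. Qed.

Lemma commute_self x : commute x x = 0.
Proof. by rewrite /commute !hit_self addr0. Qed.

Lemma commute_ge0 x y : 0 <= commute x y.
Proof. by rewrite addr_ge0 ?hit_ge0. Qed.

Lemma commute_ge2 x y : x != y -> 2 <= commute x y.
Proof.
by move=> xy; have -> : 2 = 1 + 1 :> R by []; apply: lerD; apply: hit_ge1;
  rewrite // eq_sym.
Qed.

(** * Concentration of local times *)

Definition dipole x y u : R := hit y u - hit x u + hit x y.

Lemma dipole_ge0 x y u : 0 <= dipole x y u.
Proof. by have := hit_triangle y x u; rewrite /dipole; lra. Qed.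

Lemma dipole_le x y u : dipole x y u <= commute x y.
Proof. by have := hit_triangle x y u; rewrite /dipole /commute; lra. Qed.

Lemma dipole_step x y u : x != y ->
  step (dipole x y) u = dipole x y u - (u == x)%:R / pi x + (u == y)%:R / pi y.
Proof.
move=> xy; rewrite /dipole stepD step_cst stepD.
have -> : step (fun v => - hit x v) u = - step (hit x) u.
  by rewrite -mulN1r -stepZ; apply: eq_bigr => v _; rewrite mulN1r.
have [ux|ux] := eqVneq u x.
  by subst u; rewrite (negbTE xy) (hit_step xy) hit_step_self hit_self /=; ring.
have [uy|uy] := eqVneq u y.
  by subst u; rewrite hit_step_self (hit_step ux) hit_self /=; ring.
by rewrite (hit_step ux) (hit_step uy) /=; ring.
Qed.

(** The product of the weights collected so far times the current value of [f] is a supermartingale;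
    [1 <= f] allows dropping that value at the final time. *)
Lemma walk_exp_prod_le t v (wt f : V -> R) :
  (forall u, 0 <= wt u) -> (forall u, 1 <= f u) ->
  (forall u, wt u * step f u <= f u) ->
  walk_exp t v (fun s => \prod_(u <- s) wt u) <= f v.
Proof.
move=> wt0 f1 fS; elim: t v => [|t ih] v /=.
  rewrite big_seq1; apply: le_trans (fS v); rewrite -{1}[wt v]mulr1 ler_wpM2l//.
  by rewrite -(step_cst 1 v); exact: step_monotone.
apply: le_trans (fS v); rewrite mulr_sumr; apply: ler_sum => u _.
rewrite (eq_walk_exp _ _ (F2 := fun s => wt v * \prod_(u <- s) wt u)); last first.
  by move=> s; rewrite big_cons.
by rewrite walk_expZ mulrCA ler_wpM2l// ler_wpM2l.
Qed.

Definition local_time x (s : seq V) : R := (count_mem x s)%:R / pi x.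

Lemma local_time_ge0 x s : 0 <= local_time x s.
Proof. by rewrite divr_ge0 ?ler0n// ltW. Qed.

Lemma sum_local_time s : \sum_x pi x * local_time x s = (size s)%:R.
Proof.
rewrite /local_time.
under eq_bigr => x _ do rewrite mulrCA mulfV ?mulr1 ?lt0r_neq0//.
rewrite -natr_sum; congr (_ %:R); elim: s => [|u s ih] /=.
  by rewrite big1.
rewrite big_split /= ih (bigD1 u) //= eqxx big1 ?addn0// => x.
by rewrite eq_sym => /negbTE->.
Qed.

Lemma prod_exp_count (a b : R) x y (s : seq V) :
  \prod_(u <- s) expR (a * (u == x)%:R - b * (u == y)%:R) =
  expR (a * (count_mem x s)%:R - b * (count_mem y s)%:R).
Proof.
elim: s => [|u s ih]; first by rewrite big_nil !mulr0 subrr expR0.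
by rewrite big_cons ih -expRD /= !natrD; congr expR; ring.
Qed.

(* Exponential supermartingale built from [f = 1 + theta * dipole x y], which
   lies between 1 and [1 + eta]. *)
Lemma local_time_exp_moment t v x y (delta eta : R) : x != y ->
  0 < delta -> 0 < eta -> commute x y <= delta ->
  walk_exp t v (fun s => expR (eta / delta *
     (local_time x s / (1 + eta) - local_time y s))) <= 1 + eta.
Proof.
move=> xy d0 e0 kd; pose th := eta / delta.
have th0 : 0 < th by rewrite divr_gt0.
pose f u := 1 + th * dipole x y u.
have f1 u : 1 <= f u by rewrite lerDl mulr_ge0 ?dipole_ge0// ltW.
have fe u : f u <= 1 + eta.
  rewrite lerD2l; apply: (@le_trans _ _ (th * delta)); last by rewrite divfK ?gt_eqF.
  by rewrite ler_pM2l//; apply: le_trans kd; exact: dipole_le.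
apply: le_trans (fe v); pose a := th / (pi x * (1 + eta)); pose b := th / pi y.
rewrite (eq_walk_exp _ _ (F2 := fun s =>
  \prod_(u <- s) expR (a * (u == x)%:R - b * (u == y)%:R))); last first.
  move=> s; rewrite prod_exp_count; congr expR; rewrite /a /b /local_time /th.
  by field; rewrite !gt_eqF//; lra.
apply: walk_exp_prod_le => // u.
have sf : step f u = f u - th * (u == x)%:R / pi x + th * (u == y)%:R / pi y.
  by rewrite /f stepD step_cst stepZ dipole_step//; ring.
rewrite sf; have [ux|ux] := eqVneq u x.
  subst u; rewrite (negbTE xy) /= !(mulr0, mulr1, mul0r, subr0, addr0).
  rewrite mulrC -ler_pdivlMr ?expR_gt0// -expRN.
  (* At [x] the drift is [- th / pi x]. As [f x <= 1 + eta], it is at most [- f x * a]; this is what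
     the division by [1 + eta] in the exponent pays for. *)
  apply: (@le_trans _ _ (f x * (1 - a))).
    rewrite mulrBr mulr1 lerD2l lerN2.
    have -> : f x * a = th / pi x * (f x / (1 + eta)).
      by rewrite /a; field; rewrite !gt_eqF//; lra.
    rewrite -[leRHS]mulr1 ler_pM2l ?divr_gt0//.
    by rewrite ler_pdivrMr ?mul1r//; lra.
  by rewrite ler_pM2l; [exact: expR_ge1Dx | exact: lt_le_trans (f1 x)].
have [uy|uy] := eqVneq u y.
  subst u; rewrite /= !(mulr0, mulr1, mul0r, subr0, addr0) sub0r.
  rewrite expRN mulrC ler_pdivrMr ?expR_gt0//.
  (* The dipole vanishes at [y], so [step f y] is exactly [1 + b] and no factor is lost there. *)
  have fy : f y = 1 by rewrite /f /dipole hit_self sub0r addNr mulr0 addr0.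
  by rewrite fy mul1r; exact: expR_ge1Dx.
by rewrite /= !(mulr0, mul0r, subr0, addr0) expR0 mul1r.
Qed.

(** Exponential Markov inequality applied to [local_time_exp_moment]. For equal vertices the event
    is empty. *)
Lemma local_time_tail t v x y (delta eta r : R) :
  0 < delta -> 0 < eta -> 0 <= r -> commute x y <= delta ->
  walk_exp t v (fun s =>
     ((1 + eta) * (local_time y s + r) < local_time x s)%R%:R)
  <= (1 + eta) * expR (- (eta / delta * r)).
Proof.
move=> d0 e0 r0 kd; have e1 : 0 < 1 + eta by lra.
have [xy|xy] := eqVneq x y.
  subst y; rewrite (eq_walk_exp _ _ (F2 := fun=> 0)) ?walk_exp_cst.
    by rewrite mulr_ge0 ?expR_ge0// ltW.
  move=> s; have := local_time_ge0 x s; case: ltP => // + l0.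
  rewrite ltNge => /negP[]; rewrite mulrDl mul1r -addrA lerDl.
  by rewrite addr_ge0// mulr_ge0 ?addr_ge0// ltW.
apply: (@le_trans _ _ (walk_exp t v (fun s => expR (- (eta / delta * r)) *
    expR (eta / delta * (local_time x s / (1 + eta) - local_time y s))))).
  apply: le_walk_exp => s _; case: ltP => [h|_]; last by rewrite mulr_ge0 ?expR_ge0.
  have {}h : local_time y s + r < local_time x s / (1 + eta).
    by rewrite ltr_pdivlMr// mulrC.
  rewrite -expRD -[leLHS]expR0 ler_expR -mulrN -mulrDr mulr_ge0 ?divr_ge0//.
  - exact: ltW.
  - exact: ltW.
  - by lra.
rewrite walk_expZ mulrC ler_pM2r ?expR_gt0//.
exact: local_time_exp_moment.
Qed.

(** * Matthews' lower bound *)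

Definition harmonic_sum m : R := \sum_(i < m) i.+1%:R^-1.

Lemma ln_le_harmonic_sum m : ln m.+1%:R <= harmonic_sum m.
Proof.
elim: m => [|m ih]; first by rewrite ln1 /harmonic_sum big_ord0.
rewrite /harmonic_sum big_ord_recr /= -/(harmonic_sum m).
have -> : m.+2%:R = m.+1%:R * (1 + m.+1%:R^-1) :> R.
  by rewrite mulrDr mulr1 mulfV ?pnatr_eq0// -natr1.
have h : 0 < m.+1%:R^-1 :> R by rewrite invr_gt0 ltr0n.
rewrite lnM; [|by rewrite posrE ltr0n|by rewrite posrE addr_gt0].
by apply: lerD => //; apply: le_ln1Dx; apply: lt_trans h; exact: ltrN10.
Qed.

Section Matthews.
Variables (S : {set V}) (k q : R).
Hypothesis commute_ge : forall x y, x \in S -> y \in S -> x != y -> k <= commute x y.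
Hypothesis mean_ge : forall x, x \in S -> q <= hit_mean x.

(** Matthews' estimate for a uniformly random order of [A]. Reaching the first target [a] costs
    [hit a x]; the i-th target is visited after all earlier ones with probability 1/i and then costs
    half a commute time plus half an increment of [hit_mean]. These increments telescope, from
    [- hit_mean a / 2] to at least [q / 2]. *)
Definition matthews_pot A x : R :=
  #|A|%:R^-1 * (\sum_(a in A) (hit a x - hit_mean a / 2))
  + k / 2 * (harmonic_sum #|A| - 1) + q / 2.

Definition matthews_bound A x : R :=
  if A == finset.set0 then 0 else matthews_pot A x.

(** Outside [A] every [hit a] drops by 1 on average at each step, and so does their mean over
    [A]. *)
Lemma matthews_pot_step A x : A != finset.set0 -> x \notin A ->
  1 + step (matthews_pot A) x = matthews_pot A x.
Proof.
move=> A0 xA; rewrite /matthews_pot.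
have m0 : #|A|%:R != 0 :> R by rewrite pnatr_eq0 cards_eq0.
under [X in step X]eq_fun do rewrite -addrA.
rewrite stepD step_cst stepZ.
have -> : step (fun u => \sum_(a in A) (hit a u - hit_mean a / 2)) x =
    \sum_(a in A) (hit a x - hit_mean a / 2) - #|A|%:R.
  rewrite /step; under eq_bigr do rewrite mulr_sumr.
  rewrite exchange_big -sum1_card natr_sum -sumrB; apply: eq_bigr => a aA.
  rewrite -/(step (fun u => hit a u - hit_mean a / 2) x) stepD step_cst hit_step.
    by ring.
  by apply: contraNneq xA => ->.
by rewrite mulrBr mulVf//; ring.
Qed.

(** Through [hit_commute], with m the size of [A :\ u] and Z the sum of the half commute times from
    [u] to it, the gain is (Z - m k/2) / (m (m + 1)), nonnegative by separation. If [u] was the last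
    vertex, the claim is [q <= hit_mean u]. *)
Lemma matthews_pot_visit A u : A \subset S -> A != finset.set0 ->
  matthews_pot A u <= matthews_bound (A :\ u) u.
Proof.
move=> AS A0; have [uA|uA] := boolP (u \in A); last first.
  have -> : A :\ u = A.
    by apply/finset.setP => v; rewrite !inE; case: eqVneq => // ->; rewrite (negbTE uA).
  by rewrite /matthews_bound (negbTE A0).
have uS := fintype.subsetP AS u uA.
have cA : #|A| = #|A :\ u|.+1 by rewrite (cardsD1 u A) uA.
have hS a : hit a u - hit_mean a / 2 = commute u a / 2 - hit_mean u / 2.
  by rewrite hit_commute; lra.
rewrite /matthews_bound /matthews_pot (bigD1 u) //= cA hit_self.
under eq_bigr do rewrite hS.
under [X in _ <= (if _ then _ else _ * X + _ + _)]eq_bigr do rewrite hS.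
have -> : \sum_(i in A | i != u) (commute u i / 2 - hit_mean u / 2) =
  \sum_(i in A :\ u) (commute u i / 2 - hit_mean u / 2).
  by apply: eq_bigl => i; rewrite !inE andbC.
set m := #|A :\ u|; rewrite -/m sumrB sumr_const -/m.
case: ifPn => [|] B0.
  have m0 : m = 0%N by rewrite /m (eqP B0) cards0.
  rewrite (eqP B0) big_set0 m0 /harmonic_sum big_ord_recl big_ord0.
  by have := mean_ge uS; rewrite !invr1; lra.
have m0 : (0 < m)%N by rewrite lt0n cards_eq0.
set Z := \sum_(i in _) _.
have hZ : m%:R * (k / 2) <= Z.
  rewrite mulr_natl -sumr_const; apply: ler_sum => i; rewrite !inE => /andP[iu iA].
  rewrite ler_pM2r ?invr_gt0//; apply: commute_ge => //; last by rewrite eq_sym.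
  exact: (fintype.subsetP AS).
rewrite /harmonic_sum big_ord_recr /= -/(harmonic_sum m) -[_ *+ m]mulr_natl.
have m1 : 0 < m%:R :> R by rewrite ltr0n.
rewrite -subr_ge0 -[m.+1%:R]natr1; set M := m%:R in hZ m1 *.
have -> : M^-1 * (Z - M * (hit_mean u / 2)) + k / 2 * (harmonic_sum m - 1) + q / 2 -
  ((M + 1)^-1 * (0 - hit_mean u / 2 + (Z - M * (hit_mean u / 2))) +
   k / 2 * (harmonic_sum m + (M + 1)^-1 - 1) + q / 2) =
   (Z - M * (k / 2)) / (M * (M + 1)).
  by field; rewrite !gt_eqF//; lra.
by rewrite divr_ge0 ?subr_ge0// mulr_ge0//; lra.
Qed.

(** Optional stopping truncated at time t: if part of [A] is still unvisited then, the bound at the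
    current state is at most a constant [K]. *)
Lemma matthews_bound_le_cover_sum : exists K, forall t A x, A \subset S ->
  x \notin A -> matthews_bound A x <= cover_sum t A x + K * uncovered t A x.
Proof.
pose K := \sum_(A : {set V}) \sum_x `|matthews_bound A x|.
have K0 : 0 <= K by apply: sumr_ge0 => A _; apply: sumr_ge0.
exists K; elim=> [|t ih] A x AS xA.
  have AD : A :\ x = A.
    by apply/finset.setP => v; rewrite !inE; case: eqVneq => // ->; rewrite (negbTE xA).
  rewrite cover_sum0 add0r uncovered0 AD; have [->|A0] := eqVneq A finset.set0.
    by rewrite /matthews_bound eqxx mulr0.
  rewrite mulr1; apply: le_trans (ler_norm _) _.
  rewrite /K (bigD1 A)//= (bigD1 x)//= -addrA lerDl addr_ge0//.
    by apply: sumr_ge0.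
  by apply: sumr_ge0 => B _; apply: sumr_ge0.
have [->|A0] := eqVneq A finset.set0.
  by rewrite {1}/matthews_bound eqxx addr_ge0 ?cover_sum_ge0// mulr_ge0 ?uncovered_ge0.
rewrite {1}/matthews_bound (negbTE A0) -matthews_pot_step//.
have AD : A :\ x = A.
  by apply/finset.setP => v; rewrite !inE; case: eqVneq => // ->; rewrite (negbTE xA).
rewrite cover_sumS uncoveredS AD A0 -addrA lerD2l -stepZ -stepD.
apply: step_monotone => u; apply: le_trans (matthews_pot_visit _ AS A0) _.
rewrite -(cover_sumD1 t A u) -(uncoveredD1 t A u); apply: ih.
  by apply: fintype.subset_trans AS; exact: subsetDl.
by rewrite !inE eqxx.
Qed.
End Matthews.

(** Starting at a minimiser of [hit_mean] makes its contributions at the two ends of the tour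
    cancel. Quantifying over upper bounds [B] avoids proving first that the cover time is finite. *)
Lemma matthews_lower_bound S (k : R) : (2 <= #|S|)%N -> 0 <= k ->
  (forall x y, x \in S -> y \in S -> x != y -> k <= commute x y) ->
  exists2 v, v \in S & forall B, (forall t, cover_sum t S v <= B) ->
    k / 2 * ln #|S|%:R <= B.
Proof.
move=> S2 k0 kS.
have /card_gt0P[x0 x0S] : (0 < #|S|)%N by exact: leq_trans S2.
pose v := [arg min_(v < x0 in S) hit_mean v]%O.
have [vS vmin] : v \in S /\ forall u, u \in S -> hit_mean v <= hit_mean u.
  by rewrite /v; case: arg_minP.
exists v => // B SB; pose A := S :\ v.
have cA : #|S| = #|A|.+1 by rewrite (cardsD1 v S) vS.
have A0 : A != finset.set0 by rewrite -cards_eq0 -lt0n -ltnS -cA.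
have AS : A \subset S by exact: subsetDl.
apply: (@le_trans _ _ (matthews_bound k (hit_mean v) A v)).
  rewrite /matthews_bound (negbTE A0) /matthews_pot.
  apply: (@le_trans _ _ (k / 2 * harmonic_sum #|A|)).
    by rewrite cA ler_wpM2l ?divr_ge0// ln_le_harmonic_sum.
  have m1 : 0 < #|A|%:R :> R by rewrite ltr0n lt0n cards_eq0.
  suff h : k / 2 - hit_mean v / 2 <=
      #|A|%:R^-1 * \sum_(a in A) (hit a v - hit_mean a / 2) by lra.
  rewrite ler_pdivlMl// mulr_natl -sumr_const; apply: ler_sum => a.
  rewrite !inE => /andP[av aS]; rewrite hit_commute.
  by have := kS v a vS aS; rewrite eq_sym => /(_ av); lra.
have [K bK] := matthews_bound_le_cover_sum kS vmin.
have {bK} bK t := bK t A v AS; rewrite inE inE eqxx /= in bK.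
have /cvg_ex[l cl] : cvgn (fun t => cover_sum t A v).
  apply: nondecreasing_is_cvgn; first exact: cover_sum_homo.
  by exists B => _ [t _ <-]; rewrite cover_sumD1.
have lB : l <= B.
  rewrite -(cvg_lim (@Rhausdorff R) cl); apply: limr_le.
    by apply/cvg_ex; exists l.
  by apply: nearW => t; rewrite cover_sumD1.
apply: le_trans lB.
(* The error [uncovered t A v] is the increment of a convergent sequence, so it tends to 0. *)
have cu : (fun t => cover_sum t A v + K * (cover_sum t.+1 A v - cover_sum t A v))
    t @[t --> \oo] --> l + K * (l - l).
  apply: cvgD => //; apply: cvgM; first exact: cvg_cst.
  by apply: cvgB => //; move: cl; rewrite -cvg_shiftS.
rewrite subrr mulr0 addr0 in cu.
rewrite -(cvg_lim (@Rhausdorff R) cu); apply: limr_ge.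
  by apply/cvg_ex; exists l.
apply: nearW => t; rewrite {2}/cover_sum big_ord_recr /= -/(cover_sum t A v).
by rewrite addrAC subrr add0r; apply: bK.
Qed.

(** * Chaining and the blanket time *)

Definition blanket (s : seq V) : bool :=
  [forall x, 0 < count_mem x s]%N &&
  [forall x, forall y, local_time x s <= 2 * local_time y s].

(** A separated set of maximal cardinality is a net: a vertex farther than [delta] from all its
    points could be added. *)
Lemma net_exists (delta : R) : 0 < delta -> exists Sf : {set V} * (V -> V),
  [/\ forall x y, x \in Sf.1 -> y \in Sf.1 -> x != y -> delta <= commute x y,
      forall u, Sf.2 u \in Sf.1 & forall u, commute u (Sf.2 u) <= delta].
Proof.
move=> d0; pose sep S := [forall x in S, forall y in S, (x != y) ==> (delta <= commute x y)].
have sepP S : reflect (forall x y, x \in S -> y \in S -> x != y -> delta <= commute x y) (sep S).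
  apply: (iffP forall_inP) => [h x y xS yS xy|h x xS].
    by have /forall_inP/(_ y yS)/implyP/(_ xy) := h x xS.
  by apply/forall_inP => y yS; apply/implyP; exact: h.
have sep0 : sep finset.set0 by apply/sepP => x y; rewrite inE.
pose S := [arg max_(S > finset.set0 | sep S) #|S|]%N.
have [/sepP sS maxS] : sep S /\ forall B, sep B -> (#|B| <= #|S|)%N.
  by rewrite /S; case: arg_maxnP.
have near u : exists a, a \in S /\ commute u a <= delta.
  have [uS|uS] := boolP (u \in S); first by exists u; rewrite commute_self ltW.
  apply: contrapT => /forallNP far.
  suff /maxS : sep (u |: S)%SET by rewrite cardsU1 uS add1n ltnn.
  have farS a : a \in S -> delta <= commute u a.
    by move=> aS; rewrite leNgt; apply/negP => /ltW ?; apply: (far a).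
  apply/sepP => x y; rewrite !inE => /orP[/eqP->|xS] /orP[/eqP->|yS] xy.
  - by rewrite eqxx in xy.
  - exact: farS.
  - by rewrite commuteC; exact: farS.
  - exact: sS.
have [f fP] := choice near.
by exists (S, f); split => //= u; case: (fP u).
Qed.

(** Each level costs a factor [1 + eta] and an additive [alpha]; the additive errors grow only
    linearly because they are kept inside the power. *)
Lemma chain_compare (L : V -> R) (S : nat -> {set V}) (par : nat -> V -> V)
    r (eta alpha : R) K : 0 <= eta -> 0 <= alpha -> (forall u, 0 <= L u) ->
  S 0%N = [set r]%SET ->
  (forall k u, (k < K)%N -> par k u \in S k) ->
  (forall k u, (k < K)%N -> u \in S k.+1 ->
     L u <= (1 + eta) * (L (par k u) + alpha) /\
     L (par k u) <= (1 + eta) * (L u + alpha)) ->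
  forall k u, (k <= K)%N -> u \in S k ->
    L u <= (1 + eta) ^+ k * (L r + k%:R * alpha) /\
    L r <= (1 + eta) ^+ k * (L u + k%:R * alpha).
Proof.
move=> e0 a0 L0 S0 parS Lpar; elim=> [|k ih] u kK uS.
  by move: uS; rewrite S0 inE => /eqP ->; rewrite !expr0 !mul1r mul0r addr0.
have [h1 h2] := Lpar k u kK uS.
have [h3 h4] := ih (par k u) (ltnW kK) (parS k u kK).
have ek : 1 <= (1 + eta) ^+ k by rewrite exprn_ege1// lerDl.
split.
  apply: (le_trans h1); rewrite exprS -mulrA ler_wpM2l//; first by lra.
  apply: (le_trans (lerD h3 (lexx alpha))).
  have : alpha <= (1 + eta) ^+ k * alpha by rewrite ler_peMl.
  by rewrite -[k.+1%:R]natr1; lra.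
apply: (le_trans h4); rewrite exprSr -mulrA ler_wpM2l//; first by lra.
apply: (le_trans (lerD h2 (lexx _))).
rewrite -[k.+1%:R]natr1 !mulrDl !mul1r.
have : 0 <= eta * (k%:R * alpha) by rewrite !mulr_ge0.
have : 0 <= eta * L u by rewrite mulr_ge0.
have : 0 <= eta * alpha by rewrite mulr_ge0.
rewrite !mulrDr; lra.
Qed.

(** The [pi]-average of [L] is [T], so the upper bounds force [L r] to be at least 73/100 T. At that
    value every [L x] is at most T and every [L y] at least 0.5005 T; larger values of [L r] only
    help. *)
Lemma ratio_of_compare (L : V -> R) r (a T : R) : 0 < T -> (forall u, 0 <= L u) ->
  \sum_x pi x * L x = T -> 0 < a -> a <= 20 / 17 ->
  (forall u, L u <= a * (L r + 3 / 25 * T)) ->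
  (forall u, L r <= a * (L u + 3 / 25 * T)) ->
  forall x y, 0 < L y /\ L x <= 2 * L y.
Proof.
move=> T0 L0 LT a0 aM hu hr.
have hu' u : L u <= 20 / 17 * (L r + 3 / 25 * T).
  by apply: (le_trans (hu u)); rewrite ler_wpM2r// addr_ge0//; lra.
have hr' u : L r <= 20 / 17 * (L u + 3 / 25 * T).
  by apply: (le_trans (hr u)); rewrite ler_wpM2r// addr_ge0//; lra.
have hT : T <= 20 / 17 * (L r + 3 / 25 * T).
  have : \sum_x pi x * L x <= \sum_x pi x * (20 / 17 * (L r + 3 / 25 * T)).
    by apply: ler_sum => u _; rewrite ler_wpM2l// ltW.
  by rewrite LT -mulr_suml pi_sum1 mul1r.
by move=> x y; have := hu' x; have := hr' y; split; lra.
Qed.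

Lemma expR_le_inv (x : R) : x < 1 -> expR x <= (1 - x)^-1.
Proof.
move=> x1; rewrite -[expR x]invrK -expRN lef_pV2 ?posrE ?expR_gt0 ?subr_gt0//.
exact: expR_ge1Dx.
Qed.

Lemma geometric_sum_bound (x : R) n : 0 < x ->
  \sum_(j < n) expR (- (x * j%:R)) <= 1 + x^-1.
Proof.
move=> x0; set z := expR (- x).
have z1 : z <= (1 + x)^-1.
  by rewrite /z expRN lef_pV2 ?posrE ?expR_gt0 ?expR_ge1Dx//; lra.
have zlt : x / (1 + x) <= 1 - z.
  suff -> : x / (1 + x) = 1 - (1 + x)^-1 by lra.
  by field; lra.
have zp : 0 < 1 - z by apply: lt_le_trans zlt; rewrite divr_gt0//; lra.
have -> : \sum_(j < n) expR (- (x * j%:R)) = (1 - z ^+ n) / (1 - z).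
  apply: (canRL (mulfK _)); first by rewrite gt_eqF.
  have := subrXX 1 z n; rewrite expr1n => ->; rewrite mulrC; congr (_ * _).
  by apply: eq_bigr => j _; rewrite expr1n mul1r /z -expRM_natr mulNr.
rewrite ler_pdivrMr//; apply: (@le_trans _ _ 1).
  by rewrite lerBlDr lerDl exprn_ge0// expR_ge0.
apply: (@le_trans _ _ ((1 + x^-1) * (x / (1 + x)))).
  suff -> : (1 + x^-1) * (x / (1 + x)) = 1 by [].
  by field; rewrite !gt_eqF//; lra.
by rewrite ler_wpM2l// addr_ge0// invr_ge0 ltW.
Qed.

Section Blanket.
Variables (M : R) (K : nat).
Hypothesis card_V : (2 <= #|V|)%N.
Hypothesis K_gt0 : (0 < K)%N.
Hypothesis card_V_le : (#|V| <= 2 ^ (2 ^ K))%N.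
Hypothesis separated_le : forall S (delta : R), (2 <= #|S|)%N ->
  (forall x y, x \in S -> y \in S -> x != y -> delta <= commute x y) ->
  delta * ln #|S|%:R <= M.

Let l2 : R := ln 2.
(** Inverse of the commute distance at level k: by [separated_le], a set separated at this distance
    has at most 2^(2^k) points. *)
Let scale k : R := l2 * 2 ^+ k / M.
(** Chosen so that K levels multiply to at most exp(3/20), which is below 20/17. *)
Let eta : R := 3 / 20 / K%:R.
(* [c * T = eta * alpha] with [alpha = 3 / 25 / K * T] the additive error allowed
   at each level. *)
Let c : R := 9 / 500 / K%:R ^+ 2.

Lemma ln2_ge : 2 / 3 <= l2.
Proof.
rewrite -ler_expR lnK ?posrE//.
(* Ten factors exp(1/15), each at most 15/14; the tenth power of 15/14 is just below 2. *)
have -> : 2 / 3 = 10%:R^-1 * (2 / 3) * 10%:R :> R by field.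
rewrite expRM_natr.
have h : expR (10%:R^-1 * (2 / 3)) <= 15 / 14 :> R.
  have -> : 15 / 14 = (1 - 10%:R^-1 * (2 / 3))^-1 :> R by field.
  by apply: expR_le_inv; lra.
apply: (@le_trans _ _ ((15 / 14) ^+ 10)); last by lra.
by rewrite lerXn2r ?nnegrE ?expR_ge0//; lra.
Qed.

(** Two-point sets show that [M / l2] bounds the diameter in commute time, so a single root is a net
    at level 0. *)
Lemma commute_le_M x y : commute x y * l2 <= M.
Proof.
have [->|xy] := eqVneq x y.
  rewrite commute_self mul0r.
  have /card_gt1P[a [b [_ _ ab]]] : (1 < #|V|)%N by [].
  apply: le_trans (@separated_le [set a; b]%SET 0 _ _).
  - by rewrite mul0r.
  - by rewrite cards2 ab.
  - by move=> *; exact: commute_ge0.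
apply: le_trans (@separated_le [set x; y]%SET (commute x y) _ _).
- by rewrite cards2 xy.
- by rewrite cards2 xy.
- move=> u v; rewrite !inE => /orP[/eqP->|/eqP->] /orP[/eqP->|/eqP->];
    rewrite ?eqxx // => _; by rewrite commuteC.
Qed.

Lemma M_ge : 4 / 3 <= M.
Proof.
have /card_gt1P[a [b [_ _ ab]]] : (1 < #|V|)%N by [].
apply: le_trans (commute_le_M a b).
have := ln2_ge; have := commute_ge2 ab => h1 h2.
by apply: (@le_trans _ _ (2 * (2 / 3))); [lra | apply: ler_pM; lra].
Qed.

Lemma M_gt0 : 0 < M. Proof. by apply: lt_le_trans M_ge; lra. Qed.

Lemma scale_gt0 k : 0 < scale k.
Proof.
rewrite /scale divr_gt0 ?M_gt0// mulr_gt0 ?exprn_gt0//.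
by apply: lt_le_trans ln2_ge; lra.
Qed.

Lemma K_ge1 : 1 <= K%:R :> R. Proof. by rewrite ler1n. Qed.

Lemma eta_gt0 : 0 < eta.
Proof. by rewrite divr_gt0 ?ltr0n//; lra. Qed.

Lemma eta_le : eta <= 3 / 20.
Proof. by rewrite ler_pdivrMr ?ltr0n//; have := K_ge1; lra. Qed.

Lemma c_gt0 : 0 < c.
Proof. by apply: divr_gt0; [lra | rewrite exprn_gt0// ltr0n]. Qed.

Lemma eta_expn : (1 + eta) ^+ K <= 20 / 17.
Proof.
apply: (@le_trans _ _ (expR (3 / 20))).
  have -> : 3 / 20 = eta * K%:R :> R by rewrite /eta divfK// pnatr_eq0 -lt0n.
  rewrite expRM_natr lerXn2r ?nnegrE ?expR_ge0 ?expR_ge1Dx//.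
  by have := eta_gt0; lra.
have -> : 20 / 17 = (1 - 3 / 20)^-1 :> R by field.
by apply: expR_le_inv; lra.
Qed.

Lemma level_exists (r : V) k : exists Sf : {set V} * (V -> V),
  [/\ k = 0%N -> Sf.1 = [set r]%SET, forall u, Sf.2 u \in Sf.1,
      forall u, commute u (Sf.2 u) <= (scale k)^-1
    & #|Sf.1|%:R <= expR (l2 * 2 ^+ k)].
Proof.
have l20 : 0 < l2 by apply: lt_le_trans ln2_ge; lra.
case: k => [|k].
  exists ([set r]%SET, fun=> r); split => //=.
  - by move=> u; rewrite inE.
  - by move=> u; rewrite /scale expr0 mulr1 invf_div ler_pdivlMr// commute_le_M.
  - by rewrite cards1 expr0 mulr1 lnK ?posrE//; lra.
have sk := scale_gt0 k.+1.
have [Sf [sep inS near]] := @net_exists (scale k.+1)^-1 ltac:(by rewrite invr_gt0).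
exists Sf; split => //; have [S2|S2] := leqP 2 #|Sf.1|; last first.
  apply: (@le_trans _ _ 1); first by rewrite lern1 -ltnS.
  by rewrite -expR0 ler_expR mulr_ge0 ?exprn_ge0// ltW.
have S0 : 0 < #|Sf.1|%:R :> R by rewrite ltr0n; apply: leq_trans S2.
rewrite -[leLHS]lnK ?posrE// ler_expR.
have := separated_le S2 sep; rewrite mulrC ler_pdivrMr// /scale.
by rewrite mulrC divfK// gt_eqF// M_gt0.
Qed.

Lemma blanket_tail t v :
  walk_exp t v (fun s => (~~ blanket s)%:R) <=
  \sum_(k < K) 2 * (1 + eta) *
     expR (- (c * scale k * (t.+1%:R - 2 * M / c))).
Proof.
have [Sf SfP] := choice (level_exists v).
(* The last level is the whole vertex set, whose size [card_V_le] keeps within the budget of level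
   K. *)
pose S k := if k == K then [set: V]%SET else (Sf k).1.
pose par k := (Sf k).2; pose alpha : R := 3 / 25 / K%:R * t.+1%:R.
have a0 : 0 <= alpha by rewrite !mulr_ge0// ?invr_ge0//; lra.
have e0 := eta_gt0.
pose bad x y (s : seq V) := ((1 + eta) * (local_time y s + alpha) < local_time x s).
(* Union bound over the links of the chaining tree: if no link is bad in either direction, the
   comparison with the root makes [s] a blanket. *)
apply: (@le_trans _ _ (walk_exp t v (fun s => \sum_(k < K) \sum_(u in S k.+1)
    ((bad u (par k u) s)%:R + (bad (par k u) u s)%:R)))).
  apply: le_walk_exp => s ss; case: (boolP (blanket s)) => [_|/negP nb].
    by apply: sumr_ge0 => k _; apply: sumr_ge0 => u _; rewrite addr_ge0.
  rewrite leNgt; apply/negP => lt1; apply: nb.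
  have good k u : (k < K)%N -> u \in S k.+1 ->
      ~~ bad u (par k u) s /\ ~~ bad (par k u) u s.
    move=> kK uS; apply/andP; rewrite -negb_or; apply/negP => b.
    move: lt1; rewrite ltNge => /negP; apply.
    rewrite (bigD1 (Ordinal kK))//= (bigD1 u)//= -!addrA.
    rewrite addrA; apply: ler_wpDr.
            rewrite addr_ge0//; first by apply: sumr_ge0 => *; rewrite addr_ge0.
      by apply: sumr_ge0 => k' _; apply: sumr_ge0 => *; rewrite addr_ge0.
    by case/orP: b => ->; rewrite ?lerDl ?lerDr.
  pose L u := local_time u s.
  have L0 u : 0 <= L u by exact: local_time_ge0.
  have LT : \sum_x pi x * L x = t.+1%:R by rewrite sum_local_time ss.
  have cmp : forall u, L u <= (1 + eta) ^+ K * (L v + K%:R * alpha) /\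
      L v <= (1 + eta) ^+ K * (L u + K%:R * alpha).
    move=> u; apply: (@chain_compare L S par v eta alpha K (ltW e0) a0 L0) => //.
    - by rewrite /S (ltn_eqF K_gt0); case: (SfP 0%N) => ->.
    - by move=> k w kK; rewrite /S (ltn_eqF kK); case: (SfP k) => _ h _ _; exact: h.
    - by move=> k w kK /(good _ _ kK)[b1 b2]; rewrite !leNgt.
    - by rewrite /S eqxx inE.
  have Ka : K%:R * alpha = 3 / 25 * t.+1%:R.
    by rewrite /alpha; field; rewrite pnatr_eq0 -lt0n.
  have ratio x y : 0 < L y /\ L x <= 2 * L y.
    apply: (@ratio_of_compare L v ((1 + eta) ^+ K) t.+1%:R) => //.
    - by rewrite exprn_gt0//; lra.
    - exact: eta_expn.
    - by move=> u; rewrite -Ka; case: (cmp u).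
    - by move=> u; rewrite -Ka; case: (cmp u).
  apply/andP; split.
    apply/forallP => x; have [+ _] := ratio x x.
    by rewrite /L /local_time; case: count => //; rewrite mul0r ltxx.
  by apply/forallP => x; apply/forallP => y; have [] := ratio x y.
rewrite walk_exp_sum; apply: ler_sum => k _.
have sk := scale_gt0 k.
have cS : #|S k.+1|%:R <= expR (l2 * 2 ^+ k.+1).
  rewrite /S; case: eqP => [kK|_]; last by case: (SfP k.+1).
  rewrite cardsT kK -natrX expRM_natr lnK ?posrE// -natrX ler_nat.
  by apply: leq_trans card_V_le _.
apply: (@le_trans _ _ (#|S k.+1|%:R *
    (2 * (1 + eta) * expR (- (eta / (scale k)^-1 * alpha))))).
  rewrite walk_exp_sum mulr_natl -sumr_const; apply: ler_sum => u uS.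
  have -> : walk_exp t v (fun s => (bad u (par k u) s)%:R + (bad (par k u) u s)%:R)
    = walk_exp t v (fun s => (bad u (par k u) s)%:R) +
      walk_exp t v (fun s => (bad (par k u) u s)%:R).
    have := walk_exp_sum t v [:: true; false] xpredT
      (fun b s => if b then (bad u (par k u) s)%:R else (bad (par k u) u s)%:R).
    rewrite !big_cons big_nil addr0 => <-; apply: eq_walk_exp => s.
    by rewrite !big_cons big_nil addr0.
  have dk : 0 < (scale k)^-1 by rewrite invr_gt0.
  have nr : commute u (par k u) <= (scale k)^-1 by case: (SfP k) => _ _ h _; exact: h.
  have h1 := local_time_tail t v dk e0 a0 nr.
  rewrite commuteC in nr; have h2 := local_time_tail t v dk e0 a0 nr.
  by apply: le_trans (lerD h1 h2) _; lra.
rewrite mulrCA ler_wpM2l//; first by lra.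
rewrite -ler_pdivlMr ?expR_gt0// -expRN -expRD.
(* The cardinality bound exp(l2 2^(k+1)) equals exp(c * scale k * (2 M / c)), so the union bound
   only shifts the time origin by [2 * M / c], the same at all levels. *)
apply: (le_trans cS); rewrite ler_expR invrK opprK.
have Mn : M != 0 by rewrite gt_eqF// M_gt0.
have Kn : K%:R != 0 :> R by rewrite pnatr_eq0 -lt0n.
rewrite le_eqVlt; apply/orP; left; apply/eqP.
by rewrite exprS /scale /eta /alpha /c; field; rewrite Mn Kn.
Qed.

Lemma blanket_sum_le v n :
  \sum_(t < n) walk_exp t v (fun s => (~~ blanket s)%:R) <= 500 * M * K%:R ^+ 2.
Proof.
set P := fun t => walk_exp t v (fun s => (~~ blanket s)%:R).
have P0 t : 0 <= P t.
  by rewrite -(walk_exp_cst t v 0); apply: le_walk_exp => s _; rewrite ler0n.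
have P1 t : P t <= 1.
  by rewrite -[leRHS](walk_exp_cst t v 1); apply: le_walk_exp => s _; case: blanket.
have c0 := c_gt0; have M0 := M_gt0; have K1 := K_ge1; have e1 := eta_le.
have e0 := eta_gt0.
have l20 : 0 < l2 by apply: lt_le_trans ln2_ge; lra.
(* Before this time the probabilities are bounded by 1; after it, [blanket_tail] gives a geometric
   series at each level. *)
pose N0 := (Num.trunc (2 * M / c)).+1.
have N0ge : 2 * M / c <= N0%:R by apply/ltW; exact: truncnS_gt.
have N0le : N0%:R <= 2 * M / c + 1.
  by rewrite /N0 -natr1 lerD2r truncn_le// divr_ge0//; lra.
apply: (@le_trans _ _ (\sum_(t < N0 + n) P t)).
  rewrite addnC big_split_ord /= lerDl; exact: sumr_ge0.
rewrite big_split_ord /=.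
have S1 : \sum_(i < N0) P i <= N0%:R.
  by rewrite -[leRHS](@mulr1 R) mulr_natl -[in leRHS](card_ord N0) -sumr_const; apply: ler_sum.
(* The constant 23/10 bounds [2 * (1 + eta)], as [eta <= 3 / 20]. *)
have S2 : \sum_(i < n) P (N0 + i)%N <= \sum_(k < K) 23 / 10 * (1 + (c * scale k)^-1).
  apply: (@le_trans _ _ (\sum_(i < n) \sum_(k < K) 23 / 10 *
      expR (- (c * scale k * i%:R)))).
    apply: ler_sum => i _; apply: le_trans (blanket_tail _ _) _.
    apply: ler_sum => k _; have sk := scale_gt0 k.
    apply: ler_pM; rewrite ?expR_ge0//; [by lra|by lra|].
    rewrite ler_expR lerN2 ler_pM2l; last by rewrite mulr_gt0.
    by rewrite -natr1 natrD; lra.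
  rewrite exchange_big /=; apply: ler_sum => k _; rewrite -mulr_sumr.
  by apply: ler_wpM2l; [lra | apply: geometric_sum_bound; rewrite mulr_gt0 ?scale_gt0].
have S3 : \sum_(k < K) 23 / 10 * (1 + (c * scale k)^-1) <=
    23 / 10 * (K%:R + 3 * M / c).
  rewrite -mulr_sumr; apply: ler_wpM2l; first by lra.
  rewrite big_split /= sumr_const card_ord lerD2l.
  have -> : \sum_(k < K) (c * scale k)^-1 = M / (c * l2) * \sum_(k < K) 2^-1 ^+ k.
    rewrite mulr_sumr; apply: eq_bigr => k _; rewrite /scale exprVn.
    by field; rewrite expf_neq0// !gt_eqF.
  have : \sum_(k < K) 2^-1 ^+ k <= 2 :> R.
    have := subrXX 1 (2^-1 : R) K; rewrite expr1n => e.
    have -> : \sum_(k < K) 2^-1 ^+ k = 2 * (1 - 2^-1 ^+ K) :> R.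
      rewrite e mulrA; have -> : 2 * (1 - 2^-1) = 1 :> R by field.
      by rewrite mul1r; apply: eq_bigr => k _; rewrite expr1n mul1r.
    have : 0 <= 2^-1 ^+ K :> R by rewrite exprn_ge0.
    by lra.
  move=> h; apply: (@le_trans _ _ (M / (c * l2) * 2)).
    by apply: ler_wpM2l h; exact: ltW (divr_gt0 M0 (mulr_gt0 c0 l20)).
  have -> : M / (c * l2) * 2 = M / c * (2 / l2) by field; rewrite !gt_eqF.
  have -> : 3 * M / c = M / c * 3 by rewrite -mulrA mulrC.
  rewrite (ler_pM2l (divr_gt0 M0 c0)).
  by rewrite ler_pdivrMr//; have := ln2_ge; lra.
have cV : M / c = 500 / 9 * M * K%:R ^+ 2.
  by rewrite /c; field; rewrite pnatr_eq0 -lt0n.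
(* Absorbs the lower-order terms: the total is 8.9 M/c + 1 + 2.3 K, and 8.9 M/c is below 495 M
   K^2. *)
have MK : 4 / 3 * K%:R <= M * K%:R ^+ 2.
  rewrite expr2; apply: ler_pM M_ge _; [by lra|by []|by rewrite ler_peMl].
rewrite -mulrA in S3; rewrite -mulrA in N0le; rewrite cV in N0le S3.
apply: le_trans (lerD S1 (le_trans S2 S3)) _; apply: le_trans (lerD N0le (lexx _)) _.
lra.
Qed.
End Blanket.
End Chain.

(** * From trajectories to path sums *)

Section Trajectory.
Context d (Omega : measurableType d) (R : realType).
Variables (G : multigraph) (P : probability Omega R) (v : G).
Variable X : nat -> Omega -> G.
Hypothesis XP : simple_random_walk P v X.
Hypothesis transition_sum1 : forall x : G, \sum_y transition R x y = 1.

Let p := @transition G R.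

(** The states at times before t; times 0 to t correspond to [t.+1]. *)
Definition trajectory t w : seq G := mkseq (fun s => X s w) t.

Lemma trajectoryS t w : trajectory t.+1 w = rcons (trajectory t w) (X t w).
Proof. exact: mkseqS. Qed.

Lemma take_trajectory s t w : (s <= t)%N -> take s (trajectory t w) = trajectory s w.
Proof. by move=> st; rewrite /trajectory /mkseq -map_take take_iota (minn_idPl st). Qed.

Lemma transition_ge0 x y : 0 <= p x y.
Proof. by rewrite divr_ge0. Qed.

Lemma bigcup_state (F : G -> set Omega) w :
  (\bigcup_(x in [set: G]) F x) w <-> exists x, F x w.
Proof. by split=> [[x _ Fx]|[x Fx]]; exists x. Qed.

Lemma measurable_trajectory t (Q : pred (seq G)) :
  measurable [set w | Q (trajectory t w)].
Proof.
elim: t Q => [|t ih] Q.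
  by case: (boolP (Q [::])) => q;
    [rewrite (_ : mkset _ = setT) | rewrite (_ : mkset _ = set0)] => //;
    apply/seteqP; split=> w //=; rewrite (negbTE q).
rewrite (_ : mkset _ = \bigcup_(x in [set: G])
    ([set w | Q (rcons (trajectory t w) x)] `&` [set w | X t w = x])).
  apply: fin_bigcup_measurable; first exact: finite_finset.
  move=> x _; apply: measurableI; last exact: walk_measurable XP t x.
  exact: (ih (fun s => Q (rcons s x))).
apply/seteqP; split => w; rewrite bigcup_state /= trajectoryS.
  by exists (X t w).
by move=> [x [Qx ->]].
Qed.

Lemma measure_bigcup_state (F : G -> set Omega) :
  (forall x, measurable (F x)) -> (forall x y w, F x w -> F y w -> x = y) ->
  P (\bigcup_(x in [set: G]) F x) = (\sum_(x : G) P (F x))%E.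
Proof.
move=> mF dF; rewrite measure_fin_bigcup//; first last.
- by move=> x y _ _ [w [Fx Fy]]; exact: dF Fx Fy.
- exact: finite_finset.
transitivity (\sum_(x <- index_enum G | x \in [set: G]) P (F x))%E.
  apply: fsbigE; first exact: index_enum_uniq.
    by [].
  by move=> x _; rewrite mem_index_enum.
by apply: eq_bigl => x; exact: mem_setT.
Qed.

Lemma measure_cylinderS (l : seq G) x u :
  P [set w | trajectory (size l).+2 w = rcons (rcons l x) u] =
  (P [set w | trajectory (size l).+1 w = rcons l x] * (p x u)%:E)%E.
Proof.
have fE (q : nat -> G) t : follows X q t = [set w | trajectory t.+1 w = mkseq q t.+1].
  apply/seteqP; split => w /= h.
    by apply/eq_in_map => s; rewrite mem_iota add0n ltnS => /andP[_ /h].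
  by move=> s st; move/eq_in_map: h; apply; rewrite mem_iota add0n ltnS.
pose q := nth u (rcons (rcons l x) u).
have := walk_step XP q (size l); rewrite !fE.
have -> : mkseq q (size l).+2 = rcons (rcons l x) u.
  by rewrite -[RHS](mkseq_nth u) !size_rcons.
have -> : mkseq q (size l).+1 = rcons l x.
  rewrite -[RHS](mkseq_nth u) size_rcons; apply/eq_in_map => s.
  by rewrite mem_iota add0n ltnS /q => /andP[_ sl]; rewrite nth_rcons size_rcons ltnS sl.
rewrite /q !nth_rcons size_rcons ltnS leqnn ltnn eqxx /= ltnn eqxx.
by [].
Qed.

(** Markov property given a prefix. Induction on the remaining steps, for all prefixes at once:
    split according to the next state and append it to the prefix. *)
Lemma measure_prefix t (l : seq G) x (Q : pred (seq G)) :
  P [set w | trajectory (size l).+1 w = rcons l x /\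
             Q (trajectory ((size l).+1 + t) w)] =
  (P [set w | trajectory (size l).+1 w = rcons l x] *
   (walk_exp p t x (fun s => (Q (l ++ s))%:R))%:E)%E.
Proof.
elim: t l x => [|t ih] l x.
  rewrite addn0 /= cats1; case: (boolP (Q _)) => q.
    rewrite mule1; congr (P _); apply/seteqP; split=> w /=; first by case.
    by move=> ->.
  rewrite mule0 -[RHS](measure0 P); congr (P _); apply/seteqP; split=> w //=.
  by move=> [->]; rewrite (negbTE q).
pose F u := [set w | trajectory (size l).+2 w = rcons (rcons l x) u /\
             Q (trajectory ((size l).+2 + t) w)].
have -> : [set w | trajectory (size l).+1 w = rcons l x /\
    Q (trajectory ((size l).+1 + t.+1) w)] = \bigcup_(u in [set: G]) F u.
  apply/seteqP; split => w; rewrite bigcup_state /F /= -addSnnS.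
    by move=> [e q]; exists (X (size l).+1 w); rewrite trajectoryS e.
  by move=> [u [+ q]]; rewrite trajectoryS => /rcons_inj[-> _].
rewrite measure_bigcup_state; first last.
- by move=> y z w [+ _] [+ _] => -> /rcons_inj[].
- move=> u; rewrite (_ : F u = [set w | let s := trajectory ((size l).+2 + t) w in
      (take (size l).+2 s == rcons (rcons l x) u) && Q s]).
    exact: (measurable_trajectory _ (fun s => (take _ s == _) && Q s)).
  apply/seteqP; split=> w; rewrite /F /mkset take_trajectory ?leq_addr//.
    by move=> [-> ->]; rewrite eqxx.
  by move=> /andP[/eqP].
transitivity (\sum_(u : G) (P [set w | trajectory (size l).+1 w = rcons l x] *
   (p x u * walk_exp p t u (fun s => (Q (l ++ x :: s))%:R))%:E))%E.
  apply: eq_bigr => u _; have := ih (rcons l x) u; rewrite size_rcons => ->.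
  rewrite measure_cylinderS -muleA -EFinM; congr (_ * (_ * _)%:E)%E.
  by apply: eq_walk_exp => s; rewrite cat_rcons.
rewrite -ge0_sume_distrr ?sumEFin// => u _; rewrite lee_fin mulr_ge0 ?transition_ge0//.
rewrite -(walk_exp_cst transition_sum1 t u 0); apply: (le_walk_exp transition_ge0).
by move=> s _; rewrite ler0n.
Qed.

Lemma measure_trajectory t (Q : pred (seq G)) :
  P [set w | Q (trajectory t.+1 w)] = (walk_exp p t v (fun s => (Q s)%:R))%:E.
Proof.
have m0 := walk_measurable XP 0 v.
have c1 : [set w | trajectory 1 w = [:: v]] = [set w | X 0%N w = v].
  apply/seteqP; split=> w; rewrite /trajectory /mkseq /=; first by case.
  by move=> ->.
have := measure_prefix t [::] v Q; rewrite /= add1n c1 (walk_start XP) mul1e => <-.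
rewrite (measureDI P (measurable_trajectory t.+1 Q) m0).
(* The walk starts at [v] only almost surely; the rest of the event is null. *)
have z : P ([set w | Q (trajectory t.+1 w)] `\` [set w | X 0%N w = v]) = 0%E.
  apply/eqP; rewrite eq_le measure_ge0 andbT.
  have <- : P (~` [set w | X 0%N w = v]) = 0%E.
    by rewrite probability_setC// (walk_start XP) subee.
  apply: le_measure; rewrite ?inE.
  - by apply: measurableD => //; exact: measurable_trajectory.
  - exact: measurableC.
  - by move=> w [].
apply: (etrans (congr1 (fun r => r + _)%E z)).
rewrite add0e; congr (P _); apply/seteqP; split=> w /=.
  by move=> [q e]; split=> //; rewrite /trajectory /mkseq /= e.
by move=> [[e] q].
Qed.

(** A time with values in the naturals or +oo equals the number of t strictly below it. *)
Lemma first_time_series (A : nat -> Omega -> Prop) w :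
  first_time R A w =
  (\sum_(0 <= t <oo) ((`[< forall s, (s <= t)%N -> ~ A s w >])%:R : R)%:E)%E.
Proof.
have [[t0 At0]|nA] := pselect (exists t, A t w); last first.
  have -> : first_time R A w = +oo%E.
    rewrite /first_time (_ : mkset _ = set0) ?image_set0 ?ereal_inf0//.
    by apply/seteqP; split=> t //= At; apply: nA; exists t.
  apply/esym/eq_infty => r; apply: le_trans (nneseries_lim_ge (Num.trunc r).+1 _) => //.
  rewrite (eq_bigr (fun=> 1%:E)); last first.
    by move=> t _; rewrite asboolT// => s _ As; apply: nA; exists s.
  rewrite sumEFin lee_fin sumr_const_nat subn0.
  by apply/ltW; exact: truncnS_gt.
have ex : exists t, `[< A t w >] by exists t0; apply/asboolP.
case: (ex_minnP ex) => m /asboolP Am minm.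
have -> : first_time R A w = m%:R%:E.
  apply/le_anti/andP; split; first by apply: ereal_inf_lbound; exists m.
  apply: le_ereal_inf_tmp => _ [t At <-]; rewrite lee_fin ler_nat.
  by apply: minm; apply/asboolP.
rewrite (nneseries_split 0 m)// add0n eseries0 ?adde0; last first.
  move=> t mt _; case: asboolP => // /(_ m mt); by move/(_ Am).
rewrite (eq_big_nat _ _ (F2 := fun=> 1%:E)).
  by rewrite sumEFin sumr_const_nat subn0.
move=> t /andP[_ tm]; rewrite asboolT// => s st As.
have := minm s; rewrite leqNgt (leq_ltn_trans st tm) => /(_ _)/negP.
by apply => //; apply/asboolP.
Qed.

(** Tail-sum formula, by monotone exchange of integral and series; the hypothesis says that the path
    up to t decides whether [A] has occurred by then. *)
Lemma expected_time_series (A : nat -> Omega -> Prop) (Q : pred (seq G)) :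
  (forall t w, (forall s, (s <= t)%N -> ~ A s w) <-> ~~ Q (trajectory t.+1 w)) ->
  expected_time P A =
  (\sum_(0 <= t <oo) (walk_exp p t v (fun s => (~~ Q s)%:R))%:E)%E.
Proof.
move=> AQ; rewrite /expected_time.
pose E t := [set w | ~~ Q (trajectory t.+1 w)].
have mE t : measurable (E t) := measurable_trajectory t.+1 (fun s => ~~ Q s).
transitivity (\int[P]_w (\sum_(0 <= t <oo) (\1_(E t) w)%:E))%E.
  apply: eq_integral => w _; rewrite first_time_series; apply: eq_eseriesr => t _.
  rewrite indicE; congr (_%:R%:E); congr nat_of_bool.
  apply/asboolP/idP => [/AQ h|]; first by rewrite inE.
  by rewrite inE => /AQ.
rewrite integral_nneseries//; last first.
  by move=> t; apply/measurable_realfun.measurable_EFinP/measurable_realfun.measurable_indic.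
apply: eq_eseriesr => t _; rewrite integral_indic// setIT.
exact: (measure_trajectory t (fun s => ~~ Q s)).
Qed.

End Trajectory.

(** * The walk on a connected multigraph as a reversible irreducible chain *)

Section GraphWalk.
Variables (R : realType) (G : multigraph).
Hypothesis card_G : (2 <= #|G|)%N.
Hypothesis conn_G : connected_graph G.

Lemma edges_betweenC (x y : G) : edges_between x y = edges_between y x.
Proof. by rewrite /edges_between finset.setUC. Qed.

Lemma degree_gt0 (x : G) : (0 < degree x)%N.
Proof.
have /card_gt1P[a [b [_ _ ab]]] := card_G.
have [y yx] : exists y : G, y != x.
  by have [ax|ax] := eqVneq a x; [exists b; rewrite -ax eq_sym | exists a].
have /connectP[[|z s] /=] := conn_G x y; first by move=> _ /eqP; rewrite (negbTE yx).
move=> /andP[/existsP[e /eqP xz] _] _.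
by apply/card_gt0P; exists e; rewrite inE xz !inE eqxx.
Qed.

Lemma degree_neq0 (x : G) : (degree x)%:R != 0 :> R.
Proof. by rewrite pnatr_eq0 -lt0n degree_gt0. Qed.

Lemma sum_degree_gt0 : 0 < (\sum_(x : G) degree x)%:R :> R.
Proof.
have /card_gt0P[x _] : (0 < #|G|)%N by exact: leq_trans card_G.
by rewrite ltr0n (bigD1 x)//= ltn_addr// degree_gt0.
Qed.

Lemma transition_sum1 (x : G) : \sum_y transition R x y = 1.
Proof.
rewrite /transition -mulr_suml -natr_sum.
under eq_bigr do rewrite edges_betweenC.
by rewrite sum_edges_between mulfV// degree_neq0.
Qed.

Lemma stationary_gt0 (x : G) : 0 < stationary R x.
Proof. by rewrite divr_gt0 ?sum_degree_gt0// ltr0n degree_gt0. Qed.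

Lemma stationary_sum1 : \sum_(x : G) stationary R x = 1.
Proof. by rewrite /stationary -mulr_suml -natr_sum mulfV// gt_eqF// sum_degree_gt0. Qed.

Lemma transition_reversible (x y : G) :
  stationary R x * transition R x y = stationary R y * transition R y x.
Proof.
rewrite /stationary /transition mulrC mulrA divfK ?degree_neq0//.
by rewrite [RHS]mulrC mulrA divfK ?degree_neq0// edges_betweenC.
Qed.

Lemma transition_irreducible (x y : G) :
  connect (fun u v => 0 < transition R u v) x y.
Proof.
apply: (connect_sub _ (conn_G x y)) => u v /existsP[e /eqP uv].
apply: connect1; rewrite divr_gt0 ?ltr0n ?degree_gt0//.
by apply/card_gt0P; exists e; rewrite inE uv.
Qed.
End GraphWalk.

(** * The number of levels against ln ln n *)

Lemma ln_ge_1Binv (R : realType) (x : R) : 0 < x -> 1 - x^-1 <= ln x.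
Proof.
move=> x0; have xi : 0 < x^-1 by rewrite invr_gt0.
have := @le_ln1Dx R (x^-1 - 1); rewrite addrCA subrr addr0 lnV ?posrE//.
by move=> /(_ ltac:(lra)); lra.
Qed.

(** For K at least 2, ln n exceeds 2^(K-1) ln 2, whence ln ln n is at least K/12. For K = 1 one only
    needs ln ln n away from 0: it is at most -1/6 for n = 2 and at least 2/27 for larger n. *)
Lemma sqr_levels_le (R : realType) (n K : nat) : (2 <= n)%N -> (0 < K)%N ->
  (K = 1%N \/ (2 ^ 2 ^ K.-1 < n)%N) ->
  K%:R ^+ 2 <= 200 * ln (ln n%:R) ^+ 2 :> R.
Proof.
move=> n2 K0 hK.
have ln2l := @ln2_ge R; have l20 : 0 < ln 2 :> R by lra.
have hsq (L c : R) : 0 <= c -> c <= L -> c ^+ 2 <= L ^+ 2.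
  by move=> c0 cL; rewrite lerXn2r// nnegrE; lra.
have [K1|K2] := leqP K 1.
  have -> : K = 1%N by apply/eqP; rewrite eqn_leq K1.
  have [n3|n3] := leqP 3 n; last first.
    have -> : n = 2 by apply/eqP; rewrite eqn_leq n2 -ltnS n3.
    have ln2u : ln 2 <= 5 / 6 :> R.
      have -> : 2 = (1 + 1 / 3) * (1 + 1 / 2) :> R by lra.
      rewrite lnM ?posrE; [|by lra|by lra].
      have := @le_ln1Dx R (1 / 3) ltac:(lra); have := @le_ln1Dx R (1 / 2) ltac:(lra).
      by lra.
    have := @le_ln1Dx R (ln 2 - 1) ltac:(lra); rewrite addrCA subrr addr0 => h.
    have := hsq (- ln (ln 2)) (1 / 6) ltac:(lra) ltac:(lra).
    by rewrite sqrrN; lra.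
  have ln3 : 27 / 25 <= ln n%:R :> R.
    apply: (@le_trans _ _ (ln 3)); last first.
      by rewrite ler_ln ?posrE ?ltr0n ?ler_nat//; exact: leq_trans n3.
    rewrite -ler_expR lnK ?posrE//.
    (* Here exp(27/25) is the fourth power of exp(3/100)^9, which is at most 25/19; the fourth power
       of 25/19 is just below 3. *)
    have -> : 27 / 25 = 3 / 100 * 36%:R :> R by field.
    rewrite expRM_natr (exprM _ 9 4).
    have e1 : expR (3 / 100) <= (97 / 100)^-1 :> R.
      have -> : 97 / 100 = 1 - 3 / 100 :> R by field.
      by apply: expR_le_inv; lra.
    have y9 : (97 / 100) ^- 9 <= 25 / 19 :> R.
      have h : 19 / 25 <= (97 / 100) ^+ 9 :> R by lra.
      have -> : 25 / 19 = (19 / 25)^-1 :> R by field.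
      by rewrite lef_pV2// posrE; lra.
    apply: (@le_trans _ _ ((25 / 19) ^+ 4)); last by lra.
    rewrite lerXn2r ?nnegrE ?exprn_ge0 ?expR_ge0//.
    apply: le_trans y9; rewrite -exprVn; apply: lerXn2r e1; rewrite nnegrE ?expR_ge0//.
  have := @ln_ge_1Binv R (ln n%:R) ltac:(lra).
  have : (ln n%:R)^-1 <= (27 / 25)^-1 :> R by rewrite lef_pV2 ?posrE//; lra.
  move=> h1 h2; have := hsq (ln (ln n%:R)) (2 / 27) ltac:(lra) ltac:(lra).
  by lra.
case: hK => [K1|hK]; first by rewrite K1 in K2.
have Kr : 2 <= K%:R :> R by rewrite ler_nat.
have pK : 0 < 2 ^+ K.-1 :> R by rewrite exprn_gt0.
have lnn : 2 ^+ K.-1 * ln 2 <= ln n%:R :> R.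
  have -> : 2 ^+ K.-1 * ln 2 = ln (2 ^ 2 ^ K.-1)%N%:R :> R.
    by rewrite natrX lnXn// -[ln 2 *+ _]mulr_natl natrX.
  rewrite ler_ln ?posrE ?ltr0n ?expn_gt0; first by rewrite ler_nat ltnW.
    by [].
  exact: leq_trans n2.
suff : K%:R / 12 <= ln (ln n%:R) :> R.
  move=> h; have := hsq (ln (ln n%:R)) (K%:R / 12) ltac:(lra) h.
  by have := sqr_ge0 (ln (ln n%:R) : R); rewrite expr_div_n; lra.
apply: (@le_trans _ _ (ln (2 ^+ K.-1 * ln 2))); last first.
  by rewrite ler_ln ?posrE ?mulr_gt0//; apply: lt_le_trans lnn; rewrite mulr_gt0.
rewrite lnM ?posrE// lnXn// -[ln 2 *+ _]mulr_natl.
have -> : K.-1%:R = K%:R - 1 :> R by rewrite -subn1 natrB.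
have := @ln_ge_1Binv R (ln 2) l20.
have : (ln 2)^-1 <= (2 / 3)^-1 :> R by rewrite lef_pV2 ?posrE//; lra.
have : (K%:R - 1) * (2 / 3) <= (K%:R - 1) * ln 2 :> R by rewrite ler_wpM2l//; lra.
by lra.
Qed.

(** * Identification of the expected times and the three inequalities *)

Section Times.
Variables (R : realType) (G : multigraph).
Context d (Omega : measurableType d).
Variables (P : probability Omega R) (W : G -> nat -> Omega -> G).
Hypothesis card_G : (2 <= #|G|)%N.
Hypothesis conn_G : connected_graph G.
Hypothesis walkW : forall v, simple_random_walk P v (W v).

Let p : G -> G -> R := @transition G R.
Let pi : G -> R := @stationary G R.
Let p_ge0 : forall x y, 0 <= p x y := @transition_ge0 R G.
Let p_sum1 : forall x, \sum_y p x y = 1 := transition_sum1 R card_G conn_G.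
Let pi_gt0 : forall x, 0 < pi x := stationary_gt0 R card_G conn_G.
Let pi_sum1 : \sum_x pi x = 1 := stationary_sum1 R card_G conn_G.
Let p_rev : forall x y, pi x * p x y = pi y * p y x :=
  transition_reversible R card_G conn_G.
Let p_irr : forall x y, connect (fun u v => 0 < p u v) x y :=
  transition_irreducible R card_G conn_G.

Lemma subset_trajectoryP (X : nat -> Omega -> G) (A : {set G}) t w :
  (A \subset trajectory X t.+1 w) <->
  forall x, x \in A -> exists2 s, (s <= t)%N & X s w = x.
Proof.
split=> [/fintype.subsetP sub x /sub /mapP[s]|h].
  by rewrite mem_iota add0n ltnS => /andP[_ st] ->; exists s.
apply/fintype.subsetP => x /h[s st <-]; apply: map_f.
by rewrite mem_iota add0n ltnS.
Qed.

Lemma hitting_timeE x y : hitting_time P W x y = (hit p y x)%:E.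
Proof.
rewrite /hitting_time (@expected_time_series _ _ _ _ _ _ _ (walkW x) p_sum1 _
  (fun s => [set y]%SET \subset s)); last first.
  move=> t w; split=> [h|/negP h s st Ws].
    by apply/negP => /subset_trajectoryP/(_ y); rewrite inE eqxx => /(_ isT)[s /h].
  apply: h; apply/subset_trajectoryP => u; rewrite inE => /eqP ->.
  by exists s.
rewrite (_ : (fun n => _) = EFin \o (fun n => cover_sum p n [set y]%SET x)).
  rewrite EFin_lim//; apply/cvg_ex; exists (hit p y x).
  exact: (hit_cvg p_ge0 p_sum1 pi_gt0 pi_sum1 p_rev p_irr).
by apply/funext => n /=; rewrite sumEFin big_mkord.
Qed.

Lemma commute_timeE x y : commute_time P W x y = (commute p x y)%:E.
Proof. by rewrite /commute_time !hitting_timeE -EFinD. Qed.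

(** Two distinct points in [S] rule out the default value +oo of the minimum. *)
Lemma min_commute_timeE (S : {set G}) : (2 <= #|S|)%N ->
  exists2 k, 0 <= k & min_commute_time P W S = k%:E /\
    forall x y, x \in S -> y \in S -> x != y -> k <= commute p x y.
Proof.
move=> /card_gt1P[a [b [aS bS ab]]].
have ge0 : (0 <= min_commute_time P W S)%E.
  apply: le_bigmin => [|x xS]; first exact: leey.
  apply: le_bigmin => [|y yS]; first exact: leey.
  rewrite commute_timeE lee_fin.
  exact: (commute_ge0 p_ge0 p_sum1 pi_gt0 pi_sum1 p_rev p_irr).
have lec x y : x \in S -> y \in S -> x != y ->
    (min_commute_time P W S <= (commute p x y)%:E)%E.
  move=> xS yS xy; apply: (bigmin_inf x) => //; apply: (bigmin_inf y).
    by rewrite yS xy.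
  by rewrite commute_timeE.
case E : (min_commute_time P W S) ge0 lec => [k| |] ge0 lec.
- by exists k => //; split=> // x y xS yS xy; rewrite -lee_fin lec.
- by have := lec a b aS bS ab; rewrite leye_eq.
- by [].
Qed.

Lemma max_commute_log_ge (S : {set G}) (delta : R) : (2 <= #|S|)%N ->
  (forall x y, x \in S -> y \in S -> x != y -> delta <= commute p x y) ->
  ((delta * ln #|S|%:R)%:E <= max_commute_log P W)%E.
Proof.
move=> S2 sep; apply: (Order.TotalTheory.bigmax_sup S) => //.
rewrite EFinM lee_wpmul2r ?lee_fin ?ln_ge0 ?ler1n//; first exact: leq_trans S2.
apply: le_bigmin => [|x xS]; first exact: leey.
apply: le_bigmin => [|y /andP[yS xy]]; first exact: leey.
by rewrite commute_timeE lee_fin sep.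
Qed.

Lemma expected_cover_timeE v : expected_time P (visited_all (W v)) =
  (\sum_(0 <= t <oo) (uncovered p t [set: G]%SET v)%:E)%E.
Proof.
rewrite (@expected_time_series _ _ _ _ _ _ _ (walkW v) p_sum1 _
  (fun s => [set: G]%SET \subset s))// => t w; split=> [h|/negP h s st vs].
  apply/negP => /subset_trajectoryP hs; apply: (h t) => // x.
  by apply: hs; rewrite inE.
apply: h; apply/subset_trajectoryP => x _; have [r rs <-] := vs x.
by exists r => //; exact: leq_trans st.
Qed.

Lemma visitsE (X : nat -> Omega -> G) t x w :
  visits X t x w = count_mem x (trajectory X t.+1 w).
Proof. by rewrite /visits /trajectory /mkseq count_map. Qed.

Lemma blanketedE (X : nat -> Omega -> G) t w :
  blanketed R X t w <-> blanket pi (trajectory X t.+1 w).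
Proof.
have lt x : local_time pi x (trajectory X t.+1 w) = (visits X t x w)%:R / stationary R x.
  by rewrite visitsE.
have pos x : (0 < visits X t x w)%N -> 0 < (visits X t x w)%:R / stationary R x.
  by move=> v0; rewrite divr_gt0 ?ltr0n//; exact: pi_gt0.
split=> [[vis rat]|/andP[/forallP vis /forallP rat]].
  apply/andP; split; apply/forallP => x; first by rewrite -visitsE.
  by apply/forallP => y; rewrite !lt -ler_pdivrMr// pos.
have {}vis x : (0 < visits X t x w)%N by rewrite visitsE.
split=> // x y; rewrite ler_pdivrMr ?pos// -!lt.
exact: (forallP (rat x)).
Qed.

(* The blanket property is not monotone in time, hence all prefixes. *)
Definition blanket_before (s : seq G) : bool :=
  has (fun i => blanket pi (take i.+1 s)) (iota 0 (size s)).

Lemma expected_blanket_timeE v : expected_time P (blanketed R (W v)) =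
  (\sum_(0 <= t <oo) (walk_exp p t v (fun s => (~~ blanket_before s)%:R))%:E)%E.
Proof.
rewrite (@expected_time_series _ _ _ _ _ _ _ (walkW v) p_sum1 _ blanket_before)//.
move=> t w; split=> [h|/hasPn h s st /blanketedE b].
  apply/hasPn => i; rewrite size_mkseq mem_iota add0n ltnS => /andP[_ it].
  by rewrite take_trajectory//; apply/negP => /blanketedE; exact: h.
have := h s; rewrite size_mkseq mem_iota add0n ltnS => /(_ st).
by rewrite take_trajectory// b.
Qed.

Lemma walk_exp_ge0 t v (b : pred (seq G)) : 0 <= walk_exp p t v (fun s => (b s)%:R).
Proof.
rewrite -(walk_exp_cst p_sum1 t v 0); apply: (le_walk_exp p_ge0) => s _.
by rewrite ler0n.
Qed.

Lemma cover_le_blanket v :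
  (expected_time P (visited_all (W v)) <= expected_time P (blanketed R (W v)))%E.
Proof.
rewrite expected_cover_timeE expected_blanket_timeE.
apply: lee_nneseries => [t _ _|t _]; rewrite lee_fin; first exact: walk_exp_ge0.
apply: (le_walk_exp p_ge0) => s _; rewrite ler_nat.
have [/hasP[i _ /andP[/forallP vis _]]|_] := boolP (blanket_before s); last exact: leq_b1.
 suff -> : [set: G]%SET \subset s by [].
apply/fintype.subsetP => x _; apply: (@mem_take i.+1).
by rewrite -has_pred1 has_count vis.
Qed.

Lemma max_commute_log_le_cover :
  ((2^-1)%:E * max_commute_log P W <= cover_time P W)%E.
Proof.
rewrite lee_pdivrMl//; apply: bigmax_le => [|S S2]; first exact: leNye.
have [k k0 [-> sep]] := min_commute_timeE S2.
have [v vS bnd] := matthews_lower_bound p_ge0 p_sum1 pi_gt0 pi_sum1 p_rev p_irr S2 k0 sep.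
have Cv : (expected_time P (visited_all (W v)) <= cover_time P W)%E.
  exact: (le_bigmax _ (fun v => expected_time P (visited_all (W v)))).
(* Covering the graph entails covering [S], so the truncated cover sums of [S] stay below the cover
   time. *)
have Cn n : ((cover_sum p n S v)%:E <= cover_time P W)%E.
  apply: le_trans Cv; rewrite expected_cover_timeE.
  apply: (@le_trans _ _ (\sum_(0 <= t < n) (uncovered p t [set: G]%SET v)%:E)%E).
    rewrite sumEFin lee_fin big_mkord; apply: ler_sum => t _.
    apply: (le_walk_exp p_ge0) => s _; rewrite ler_nat.
    case: (boolP ([set: G]%SET \subset s)) => [Ts|_]; last by case: (_ \subset _).
    by rewrite (fintype.subset_trans (finset.subsetT S) Ts).
  apply: nneseries_lim_ge => t _ _; rewrite lee_fin; exact: walk_exp_ge0.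
case E : (cover_time P W) Cn => [c| |] Cn.
- rewrite -!EFinM lee_fin; have := bnd c (fun n => Cn n); lra.
- by rewrite gt0_muley ?leey// lte_fin.
- by have := Cn 0%N.
Qed.

Lemma blanket_le_max_commute_log : (blanket_time P W
    <= (10 ^+ 5)%:E * max_commute_log P W * (ln (ln #|G|%:R) ^+ 2)%:E)%E.
Proof.
(* The least positive K with n at most 2^(2^K): the upper bound lets the chaining reach all
   vertices, minimality makes K of order ln ln n. *)
have [K K0 [hK Kn]] : exists2 K, (0 < K)%N &
    (K = 1%N \/ (2 ^ 2 ^ K.-1 < #|G|)%N) /\ (#|G| <= 2 ^ 2 ^ K)%N.
  have ex : exists K, (0 < K)%N && (#|G| <= 2 ^ 2 ^ K)%N.
    exists #|G|.+1; rewrite /=; apply: leq_trans (ltnW (ltn_expl _ (ltnSn 1))) _.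
    rewrite leq_exp2l//; apply: leq_trans (ltnW (ltn_expl _ (ltnSn 1))) _.
    by rewrite leq_exp2l.
  case: (ex_minnP ex) => K /andP[K0 Kn] minK; exists K => //; split=> //.
  case: K K0 Kn minK => [//|[|K]] _ _ minK; first by left.
  right; rewrite ltnNge; apply/negP => le.
  by have := minK K.+1; rewrite /= le ltnn => /(_ isT).
have lnK := @sqr_levels_le R _ K card_G K0 hK.
have K1 : 1 <= K%:R ^+ 2 :> R by rewrite exprn_ege1// ler1n.
set L := ln (ln #|G|%:R) ^+ 2 in lnK *.
have L0 : 0 < L by lra.
have sepM := max_commute_log_ge.
have M0 : (0 <= max_commute_log P W)%E.
  have := @sepM [set: G]%SET 0; rewrite mul0r => h; apply: h.
    by rewrite cardsT.
  move=> x y _ _ _; exact: (commute_ge0 p_ge0 p_sum1 pi_gt0 pi_sum1 p_rev p_irr).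
case E : (max_commute_log P W) M0 sepM => [m| |] M0 sepM //; last first.
  rewrite gt0_muley ?lte_fin ?exprn_gt0// gt0_mulye ?lte_fin//.
  exact: leey.
rewrite -!EFinM; apply: bigmax_le => [|v _]; first exact: leNye.
rewrite expected_blanket_timeE; apply: lime_le.
  by apply: is_cvg_nneseries => t _ _; rewrite lee_fin walk_exp_ge0.
apply: nearW => n; rewrite sumEFin lee_fin big_mkord.
have sepm : forall (S : {set G}) delta, (2 <= #|S|)%N ->
    (forall x y, x \in S -> y \in S -> x != y -> delta <= commute p x y) ->
    delta * ln #|S|%:R <= m.
  by move=> S delta S2 sep; rewrite -lee_fin; exact: sepM.
have := blanket_sum_le p_ge0 p_sum1 pi_gt0 pi_sum1 p_rev p_irr card_G K0 Kn sepm v n.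
move=> h; apply: (@le_trans _ _ (500 * m * K%:R ^+ 2)).
  (* If no prefix is a blanket, neither is the whole path, and this is the event that
     [blanket_sum_le] controls. *)
  apply: le_trans h; apply: ler_sum => t _; apply: (le_walk_exp p_ge0) => s ss.
  rewrite ler_nat; have [//|/hasPn nb] := boolP (blanket_before s).
  have := nb t; rewrite mem_iota ss add0n leqnn => /(_ isT).
  by rewrite -ss take_size => ->.
rewrite lee_fin in M0.
have m500 : 0 <= 500 * m := mulr_ge0 (ler0n R 500) M0.
(* The final constant is 500 times 200. *)
apply: (le_trans (ler_wpM2l m500 lnK)); rewrite le_eqVlt; apply/orP; left.
by apply/eqP; ring.
Qed.
End Times.

Theorem theorem1p3 (R : realType) (G : multigraph)
    (d : measure_display) (Omega : measurableType d) (P : probability Omega R)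
    (W : G -> nat -> Omega -> G) :
  (2 <= #|G|)%N ->
  connected_graph G ->
  (forall v, simple_random_walk P v (W v)) ->
  [/\ ((2^-1)%:E * max_commute_log P W <= cover_time P W)%E,
      (cover_time P W <= blanket_time P W)%E
    & (blanket_time P W
         <= (10 ^+ 5)%:E * max_commute_log P W * (ln (ln #|G|%:R) ^+ 2)%:E)%E].
Proof.
move=> card_G conn_G walkW; split.
- exact: max_commute_log_le_cover.
- by apply: le_bigmax2 => v _; exact: cover_le_blanket.
- exact: blanket_le_max_commute_log.
Qed.
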